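(* Assume that: (Hp1) $H$ is a real Hilbert space, and $A$ is a self-adjoint nonnegative linear operator on $H$ with dense domain $D(A)$; (Hp2) $F:D(A^{1/2})\to[0,+\infty)$ is a nonnegative function with $F(0)=0$; (Hp3) $F$ has a gradient $\nabla F:D(A^{1/2})\to H$, in the sense that for every $u\in D(A^{1/2})$ $$\lim_{|v|_{D(A^{1/2})}\to 0}\frac{F(u+v)-F(u)-\langle\nabla F(u),v\rangle}{|v|}=0;$$ (Hp4) $\nabla F$ is locally Lipschitz continuous, in the sense that there is a function $L:\mathbb{R}^2\to\mathbb{R}$, bounded on bounded sets, such that $$|\nabla F(u)-\nabla F(v)|\leq L\left(|u|_{D(A^{1/2})},|v|_{D(A^{1/2})}\right)\cdot|u-v|_{D(A^{1/2})}\qquad\forall u,v\in D(A^{1/2});$$ (Hp5) there exists a constant $K>0$ such that $\langle\nabla F(u),u\rangle\geq K\cdot F(u)$ for every $u\in D(A^{1/2})$; (Hp6) there exist $p>0$ and a function $R_1:\mathbb{R}\to\mathbb{R}$, bounded on bounded sets, such that $$|u|^{p+2}\leq R_1\left(|u|_{D(A^{1/2})}\right)\cdot\left(|A^{1/2}u|^2+F(u)\right)\qquad\forall u\in D(A^{1/2}).$$ Let $(u_0,u_1)\in D(A^{1/2})\times H$, and let $u\in C^0([0,+\infty);D(A^{1/2}))\cap C^1([0,+\infty);H)$ be the unique global weak solution of $$u''(t)+u'(t)+Au(t)+\nabla F(u(t))=0\quad\forall t\ge 0,\qquad u(0)=u_0,\quad u'(0)=u_1 .$$ Then there exist constants $M_1$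 and $M_2$ such that $$|u'(t)|^2+|A^{1/2}u(t)|^2+F(u(t))\leq\frac{M_1}{(1+t)^{1+2/p}}\qquad\forall t\geq 0,$$ $$|u(t)|\leq\frac{M_2}{(1+t)^{1/p}}\qquad\forall t\geq 0.$$
   Context: $|\cdot|$ and $\langle\cdot,\cdot\rangle$ denote the norm and scalar product of $H$. $A$ nonnegative means $\langle Au,u\rangle\ge 0$ for all $u\in D(A)$, and $D(A^{1/2})$ is a Hilbert space with norm $|u|_{D(A^{1/2})}:=(|u|^2+|A^{1/2}u|^2)^{1/2}$. Weak solution: writing $U=(u,u')$, $\mathcal{H}=D(A^{1/2})\times H$ with its product norm, $\mathcal{A}(u,v)=(-v,Au+u)$ with domain $D(A)\times D(A^{1/2})$ (a skew-adjoint operator on $\mathcal{H}$) and $\mathcal{F}(u,v)=(0,u-\nabla F(u)-v)$, $u$ is a weak solution on an interval $[0,T)$ (with $T\le+\infty$) if $u\in C^0([0,T);D(A^{1/2}))\cap C^1([0,T);H)$ and $U$ is a mild solution of $U'+\mathcal{A}U=\mathcal{F}(U)$, $U(0)=(u_0,u_1)$, i.e. $U(t)=e^{-t\mathcal{A}}U(0)+\int_0^te^{-(t-s)\mathcal{A}}\mathcal{F}(U(s))\,ds$ for every $t\in[0,T)$. Under (Hp1)-(Hp4), for every $(u_0,u_1)\in D(A^{1/2})\times H$ the problem has a unique global weak solution (i.e. with $T=+\infty$). *)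

(* Defs.v *)
From Stdlib Require Import Reals Lra Classical.
From Coquelicot Require Import Coquelicot.

Set Implicit Arguments.
Unset Strict Implicit.
Unset Printing Implicit Defensive.

Open Scope R_scope.

(* Stdlib's [Rpower] satisfies [Rpower 0 a = 1]; [rpow] is the power function
   on [0, +oo) for a positive exponent, with [rpow 0 a = 0]. *)
Definition rpow (x a : R) : R := if Req_EM_T x 0 then 0 else Rpower x a.

(* Completeness is that of the underlying [CompleteNormedModule], whose balls
   are equivalent to those of its norm. *)
Record HilbertSpace := {
  hilbert_module :> CompleteNormedModule R_AbsRing;
  inner : hilbert_module -> hilbert_module -> R;
  inner_sym : forall x y, inner x y = inner y x;
  inner_plus_l : forall x y z, inner (plus x y) z = inner x z + inner y z;
  inner_scal_l : forall (k : R) x y, inner (scal k x) y = k * inner x y;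
  inner_pos : forall x, 0 <= inner x x;
  inner_norm : forall x, norm x = sqrt (inner x x)
}.

Record operator (E E' : NormedModule R_AbsRing) := {
  dom : E -> Prop;
  dom_zero : dom zero;
  dom_plus : forall x y, dom x -> dom y -> dom (plus x y);
  dom_scal : forall (k : R) x, dom x -> dom (scal k x);
  app :> {x : E | dom x} -> E';
  app_plus : forall x y z : {x : E | dom x},
    proj1_sig z = plus (proj1_sig x) (proj1_sig y) ->
    app z = plus (app x) (app y);
  app_scal : forall (k : R) (x z : {x : E | dom x}),
    proj1_sig z = scal k (proj1_sig x) -> app z = scal k (app x)
}.

Definition Dom (E E' : NormedModule R_AbsRing) (T : operator E E') : Type :=
  {x : E | dom T x}.

Definition emb (E E' : NormedModule R_AbsRing) (T : operator E E')
  (x : Dom T) : E := proj1_sig x.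

Definition graph (E E' : NormedModule R_AbsRing) (T : operator E E')
  (x : E) (y : E') : Prop := exists x' : Dom T, emb x' = x /\ T x' = y.

(* [Dom T] is normed by the graph norm, so [Dom B] is D(A^{1/2}) with the norm
   (|u|^2 + |A^{1/2} u|^2)^{1/2} when [B] is A^{1/2}. *)
Section GraphNorm.

Variables (E E' : NormedModule R_AbsRing) (T : operator E E').

Lemma Dom_eq (x y : Dom T) : emb x = emb y -> x = y.
Proof.
destruct x as [x hx], y as [y hy]; unfold emb; simpl; intros e.
subst y; f_equal; apply proof_irrelevance.
Qed.

Definition Dom_zero : Dom T := exist _ zero (dom_zero T).

Definition Dom_plus (x y : Dom T) : Dom T :=
  exist _ (plus (proj1_sig x) (proj1_sig y))
    (dom_plus (proj2_sig x) (proj2_sig y)).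

Definition Dom_scal (k : R) (x : Dom T) : Dom T :=
  exist _ (scal k (proj1_sig x)) (dom_scal k (proj2_sig x)).

Definition Dom_opp (x : Dom T) : Dom T := Dom_scal (- 1) x.

Definition Dom_AbelianMonoid_mixin : AbelianMonoid.mixin_of (Dom T).
Proof.
apply (@AbelianMonoid.Mixin (Dom T) Dom_plus Dom_zero); intros; apply Dom_eq.
- apply plus_comm.
- apply plus_assoc.
- apply plus_zero_r.
Defined.

Canonical Dom_AbelianMonoid :=
  AbelianMonoid.Pack (Dom T) Dom_AbelianMonoid_mixin (Dom T).

Lemma Dom_plus_opp (x : Dom T) : plus x (Dom_opp x) = zero.
Proof.
apply Dom_eq; change (plus (emb x) (scal (opp one : R) (emb x)) = zero).
rewrite scal_opp_one; apply (@plus_opp_r E).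
Qed.

Canonical Dom_AbelianGroup :=
  AbelianGroup.Pack (Dom T)
    (AbelianGroup.Class _ _ (AbelianGroup.Mixin _ _ Dom_plus_opp)) (Dom T).

Definition Dom_ModuleSpace_mixin :
  ModuleSpace.mixin_of R_Ring Dom_AbelianGroup.
Proof.
apply (@ModuleSpace.Mixin R_Ring Dom_AbelianGroup Dom_scal);
  intros; apply Dom_eq.
- apply (@scal_assoc R_Ring E).
- apply (@scal_one R_Ring E).
- apply (@scal_distr_l R_Ring E).
- apply (@scal_distr_r R_Ring E).
Defined.

Canonical Dom_ModuleSpace :=
  ModuleSpace.Pack R_Ring (Dom T)
    (ModuleSpace.Class _ _ _ Dom_ModuleSpace_mixin) (Dom T).

Definition Dom_norm (x : Dom T) : R := sqrt (norm (emb x) ^ 2 + norm (T x) ^ 2).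

Definition Dom_ball (x : Dom T) (eps : R) (y : Dom T) : Prop :=
  Dom_norm (minus y x) < eps.

Lemma app_Dom_plus (x y : Dom T) : T (plus x y) = plus (T x) (T y).
Proof. now apply app_plus. Qed.

Lemma app_Dom_scal (k : R) (x : Dom T) : T (scal k x) = scal k (T x).
Proof. now apply app_scal. Qed.

Lemma Dom_norm_triangle (x y : Dom T) :
  Dom_norm (plus x y) <= Dom_norm x + Dom_norm y.
Proof.
unfold Dom_norm; rewrite app_Dom_plus.
exact (prod_norm_triangle (emb x, T x) (emb y, T y)).
Qed.

Lemma Dom_norm_scal (k : R) (x : Dom T) :
  Dom_norm (scal k x) <= Rabs k * Dom_norm x.
Proof.
unfold Dom_norm; rewrite app_Dom_scal.
exact (@prod_norm_scal R_AbsRing E E' k (emb x, T x)).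
Qed.

Lemma Dom_norm_eq_zero (x : Dom T) : Dom_norm x = 0 -> x = zero.
Proof.
intros e; apply Dom_eq.
exact (f_equal fst (prod_norm_eq_zero (emb x, T x) e)).
Qed.

Lemma Dom_norm_zero : Dom_norm zero = 0.
Proof.
assert (h := Dom_norm_scal 0 zero).
rewrite Rabs_R0, Rmult_0_l in h.
apply Rle_antisym; [| apply sqrt_pos].
apply Rle_trans with (2 := h); right; f_equal; symmetry.
exact (@scal_zero_r R_Ring Dom_ModuleSpace 0).
Qed.

Lemma Dom_norm_opp (x : Dom T) : Dom_norm (opp x) <= Dom_norm x.
Proof.
assert (h := Dom_norm_scal (Ropp 1) x).
rewrite Rabs_Ropp, Rabs_R1, Rmult_1_l in h; exact h.
Qed.

Lemma Dom_ball_center (x : Dom T) (e : posreal) : Dom_ball x e x.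
Proof.
unfold Dom_ball; replace (minus x x) with (zero : Dom T).
- rewrite Dom_norm_zero; apply cond_pos.
- symmetry; exact (@plus_opp_r Dom_AbelianGroup x).
Qed.

Lemma Dom_ball_sym (x y : Dom T) (e : R) : Dom_ball x e y -> Dom_ball y e x.
Proof.
unfold Dom_ball; intros h; replace (minus x y) with (opp (minus y x)).
- now apply Rle_lt_trans with (1 := Dom_norm_opp _).
- exact (@opp_minus Dom_AbelianGroup y x).
Qed.

Lemma Dom_ball_triangle (x y z : Dom T) (e1 e2 : R) :
  Dom_ball x e1 y -> Dom_ball y e2 z -> Dom_ball x (e1 + e2) z.
Proof.
unfold Dom_ball; intros h1 h2.
replace (minus z x) with (plus (minus z y) (minus y x)).
- apply Rle_lt_trans with (1 := Dom_norm_triangle _ _); lra.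
- symmetry; exact (@minus_trans Dom_AbelianGroup y z x).
Qed.

Canonical Dom_UniformSpace :=
  UniformSpace.Pack (Dom T)
    (UniformSpace.Mixin _ Dom_zero _
       Dom_ball_center Dom_ball_sym Dom_ball_triangle) (Dom T).

Canonical Dom_NormedModuleAux :=
  NormedModuleAux.Pack R_AbsRing (Dom T)
    (NormedModuleAux.Class R_AbsRing _
       (ModuleSpace.class R_Ring Dom_ModuleSpace)
       (UniformSpace.class Dom_UniformSpace)) (Dom T).

Definition Dom_NormedModule_mixin :
  NormedModule.mixin_of R_AbsRing Dom_NormedModuleAux.
Proof.
apply (@NormedModule.Mixin R_AbsRing Dom_NormedModuleAux Dom_norm 1).
- exact Dom_norm_triangle.
- exact Dom_norm_scal.
- intros x y eps h; exact h.
- intros x y eps h; rewrite Rmult_1_l; exact h.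
- exact Dom_norm_eq_zero.
Defined.

Canonical Dom_NormedModule :=
  NormedModule.Pack R_AbsRing (Dom T)
    (NormedModule.Class R_AbsRing _ _ Dom_NormedModule_mixin) (Dom T).

End GraphNorm.

Definition dense_domain (E E' : NormedModule R_AbsRing) (T : operator E E') :=
  forall (x : E) (eps : posreal), exists u : Dom T, ball x eps (emb u).

(* The second field says that the graph of the adjoint is the graph of [T]. *)
Record self_adjoint (H : HilbertSpace) (T : operator H H) : Prop := {
  self_adjoint_dense : dense_domain T;
  self_adjoint_graph : forall v w : H,
    (forall u : Dom T, inner (T u) v = inner (emb u) w) <-> graph T v w
}.

Definition nonneg_operator (H : HilbertSpace) (T : operator H H) : Prop :=
  forall u : Dom T, 0 <= inner (T u) (emb u).

(* [B] is [A^{1/2}]: the nonnegative self-adjoint operator with [B o B = A],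
   equality of domains included. *)
Record is_sqrt_operator (H : HilbertSpace) (A B : operator H H) : Prop := {
  sqrt_self_adjoint : self_adjoint B;
  sqrt_nonneg : nonneg_operator B;
  sqrt_square : forall u w : H,
    graph A u w <-> exists v : H, graph B u v /\ graph B v w
}.

(* [S t] is [e^{tT}], the strongly continuous group with generator [T]. *)
Record is_exp_group (X : NormedModule R_AbsRing) (T : operator X X)
    (S : R -> X -> X) : Prop := {
  exp_group_linear : forall t, is_linear (S t);
  exp_group_0 : forall x, S 0 x = x;
  exp_group_plus : forall s t x, S (s + t) x = S s (S t x);
  exp_group_continuous : forall x, continuous (fun t => S t x) 0;
  exp_group_generator : forall x y,
    is_derive (fun t => S t x) 0 y <-> graph T x y
}.

(* The operator [(u, v) |-> (- v, A u + u)] on [D(B) x H], with domain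
   [D(A) x D(B)], where [B] stands for [A^{1/2}]. *)
Section WaveOperator.

Lemma plus_plus_swap (G : AbelianGroup) (a b c d : G) :
  plus (plus a b) (plus c d) = plus (plus a c) (plus b d).
Proof.
rewrite <- !plus_assoc; f_equal; rewrite !plus_assoc; f_equal.
apply plus_comm.
Qed.

Variables (H : HilbertSpace) (A B : operator H H).

Definition energy_space : NormedModule R_AbsRing :=
  prod_NormedModule R_AbsRing (Dom_NormedModule B) H.

Definition wave_dom (U : energy_space) : Prop :=
  dom A (emb (fst U)) /\ dom B (snd U).

Definition wave_app (U : {U : energy_space | wave_dom U}) : energy_space :=
  let u := fst (proj1_sig U) in
  let uA : Dom A := exist _ (emb u) (proj1 (proj2_sig U)) in
  let vB : Dom B := exist _ (snd (proj1_sig U)) (proj2 (proj2_sig U)) in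
  (opp vB, plus (A uA) (emb u)).

Lemma wave_dom_zero : wave_dom zero.
Proof. split; apply dom_zero. Qed.

Lemma wave_dom_plus (U V : energy_space) :
  wave_dom U -> wave_dom V -> wave_dom (plus U V).
Proof. intros [h1 h2] [h3 h4]; split; now apply dom_plus. Qed.

Lemma wave_dom_scal (k : R) (U : energy_space) :
  wave_dom U -> wave_dom (scal k U).
Proof. intros [h1 h2]; split; now apply dom_scal. Qed.

Lemma wave_app_plus (U V W : {U : energy_space | wave_dom U}) :
  proj1_sig W = plus (proj1_sig U) (proj1_sig V) ->
  wave_app W = plus (wave_app U) (wave_app V).
Proof.
destruct U as [[u u'] hu], V as [[v v'] hv], W as [w hw].
simpl; intros e; subst w.
unfold wave_app; simpl in *.
apply injective_projections; simpl.
- apply Dom_eq; exact (@scal_distr_l R_Ring H (- 1) u' v').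
- rewrite (app_plus (x := exist (dom A) _ (proj1 hu)) (y := exist (dom A) _ (proj1 hv)));
    [| reflexivity].
  apply (@plus_plus_swap H).
Qed.

Lemma wave_app_scal (k : R) (U W : {U : energy_space | wave_dom U}) :
  proj1_sig W = scal k (proj1_sig U) -> wave_app W = scal k (wave_app U).
Proof.
destruct U as [[u u'] hu], W as [w hw].
simpl; intros e; subst w.
unfold wave_app; simpl in *.
apply injective_projections; simpl.
- apply Dom_eq.
  transitivity (scal (mult (- 1) k) u' : H).
  + exact (@scal_assoc R_Ring H (- 1) k u').
  + rewrite (Rmult_comm (- 1) k : mult (- 1) k = mult k (- 1)).
    symmetry; exact (@scal_assoc R_Ring H k (- 1) u').
- rewrite (app_scal (k := k) (x := exist (dom A) _ (proj1 hu))); [| reflexivity].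
  symmetry; apply (@scal_distr_l R_Ring H).
Qed.

Definition wave_operator : operator energy_space energy_space :=
  {| dom := wave_dom; dom_zero := wave_dom_zero;
     dom_plus := wave_dom_plus; dom_scal := wave_dom_scal;
     app := wave_app; app_plus := wave_app_plus; app_scal := wave_app_scal |}.

End WaveOperator.

Definition forcing (H : HilbertSpace) (B : operator H H) (gradF : Dom B -> H)
    (U : energy_space B) : energy_space B :=
  (zero, minus (minus (emb (fst U)) (gradF (fst U))) (snd U)).

Definition time_interval (T : Rbar) (t : R) : Prop := 0 <= t /\ Rbar_lt t T.

(* Values outside [I] are irrelevant: the derivative at [t] is taken within
   [I], hence is one-sided at an end point. *)
Definition is_C1_on (V : NormedModule R_AbsRing) (I : R -> Prop)
    (u du : R -> V) : Prop :=
  (forall t, I t ->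
     filterdiff u (within I (locally t)) (fun h : R => scal h (du t))) /\
  continuous_on I du.

(* [u] is a weak solution on [[0, T)] of u'' + u' + A u + gradF u = 0, with
   [u' = du] and initial data [(u0, u1)]; [B] stands for [A^{1/2}]. *)
Definition is_weak_solution (H : HilbertSpace) (A B : operator H H)
    (gradF : Dom B -> H) (u0 : Dom B) (u1 : H) (T : Rbar)
    (u : R -> Dom B) (du : R -> H) : Prop :=
  let I := time_interval T in
  let U : R -> energy_space B := fun t => (u t, du t) in
  continuous_on I u /\
  is_C1_on I (fun t => emb (u t)) du /\
  U 0 = (u0, u1) /\
  exists S : R -> energy_space B -> energy_space B,
    is_exp_group (wave_operator A B) S /\
    forall t, I t -> exists J : energy_space B,
      is_RInt (fun s => S (- (t - s)) (forcing gradF (U s))) 0 t J /\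
      U t = plus (S (- t) (U 0)) J.

Definition bounded_on_bounded_sets (V : NormedModule R_AbsRing) (f : V -> R) :=
  forall r : R, exists C : R, forall x : V, norm x <= r -> Rabs (f x) <= C.

Definition is_gradient (H : HilbertSpace) (B : operator H H)
    (F : Dom B -> R) (gradF : Dom B -> H) : Prop :=
  forall u : Dom B,
    filterlim
      (fun v : Dom B =>
         (F (plus u v) - F u - inner (gradF u) (emb v)) / norm (emb v))
      (locally' (zero : Dom B)) (locally 0).

(* Main.v *)
(* Pulled back along the wave group, which is isometric for the energy norm, a
   mild solution becomes a C^1 curve. This gives the derivative of the linear
   energy, and that of the product of the solution with a fixed element of the
   domain of the generator, without regularizing the data; as the remainder in
   (Hp3) is small in the norm of H, F(u) is differentiable in time too. Hence
   E = (|u'|^2 + |A^{1/2}u|^2)/2 + F(u) satisfies E' = -|u'|^2, and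
   Phi = <u',u> + |u|^2/2 + 3E satisfies Phi' <= -delta E by (Hp5). Moreover
   |u|^2/4 + E <= Phi <= |u|^2 + 5E, so (Hp6) gives Phi^{1+p/2} <= C E, whence
   Phi = O(t^{-2/p}). Since E is nonincreasing, integrating Phi' <= -delta E over
   [t/2, t] gains the remaining factor 1/t. *)
Require Import Defs.
From Stdlib Require Import Reals Lra Classical.
From Coquelicot Require Import Coquelicot.
Open Scope R_scope.

(** * Calculus in normed modules *)

(** The group [S] is known only through its generator, so its isometry has to be proved.
    Skew-symmetry conserves the norm along orbits that start in the domain of the generator, and
    density of that domain extends this to all orbits. Density rests on time averages, hence on
    integrals in the energy space. As [Dom B] carries no completeness structure, these integrals are
    computed in [H], one component at a time, and self-adjointness of [B] brings them back into the
    domain. The shape of Phi comes from the derivative of <u',u>. It contains +|u'|^2, which has the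
    wrong sign, and -<u',u>, which has no sign. The derivative of |u|^2/2 cancels the latter, and
    the dissipation of a multiple of E absorbs the former. The multiple 3 also pays for the lower
    bound: |<u',u>| <= |u|^2/4 + |u'|^2 costs at most |u|^2/4 + 2E, so |u|^2/4 + E remains. *)

Lemma continuous_of_norm_bound (T : UniformSpace) (V : NormedModule R_AbsRing)
  (f : T -> V) (k : T -> R) (t : T) :
  locally t (fun s => norm (minus (f s) (f t)) <= k s) ->
  continuous k t -> k t = 0 -> continuous f t.
Proof.
intros hb hk hk0.
apply (proj2 (filterlim_locally_ball_norm f (f t))); intros eps.
assert (hke := proj1 (filterlim_locally k (k t)) hk eps).
generalize (filter_and _ _ hb hke); apply filter_imp; intros s [hs' hs].
apply Rle_lt_trans with (1 := hs').
assert (h : Rabs (k s - k t) < eps) by exact hs.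
rewrite hk0 in h; apply Rabs_lt_between in h; lra.
Qed.

Lemma continuous_norm (T : UniformSpace) (V : NormedModule R_AbsRing)
  (f : T -> V) (t : T) :
  continuous f t -> continuous (fun s => norm (f s)) t.
Proof.
intros hf.
apply (proj2 (filterlim_locally _ _)); intros eps.
assert (h := proj1 (filterlim_locally_ball_norm f (f t)) hf eps).
revert h; apply filter_imp; intros s hs.
exact (Rle_lt_trans _ _ _ (norm_triangle_inv (f s) (f t)) hs).
Qed.

Lemma continuous_minus_const (T : UniformSpace) (V : NormedModule R_AbsRing)
  (f : T -> V) (c : V) (t : T) :
  continuous f t -> continuous (fun s => minus (f s) c) t.
Proof.
intros hf; apply (continuous_minus (V := V)); [exact hf | apply continuous_const].
Qed.

Lemma norm_minus_self (V : NormedModule R_AbsRing) (x : V) : norm (minus x x) = 0.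
Proof. rewrite (minus_eq_zero (G := V)); apply norm_zero. Qed.

Lemma norm_scal_R (V : NormedModule R_AbsRing) (k : R) (x : V) :
  norm (scal k x) <= Rabs k * norm x.
Proof. exact (norm_scal k x). Qed.

Lemma scal_inv_l (V : ModuleSpace R_Ring) (k : R) (x : V) :
  k <> 0 -> scal (/ k) (scal k x) = x.
Proof.
intros hk; rewrite scal_assoc; unfold mult; simpl.
rewrite Rinv_l by exact hk; apply (scal_one (V := V)).
Qed.

Lemma scal_inv_r (V : ModuleSpace R_Ring) (k : R) (x : V) :
  k <> 0 -> scal k (scal (/ k) x) = x.
Proof.
intros hk; rewrite scal_assoc; unfold mult; simpl.
rewrite Rinv_r by exact hk; apply (scal_one (V := V)).
Qed.

(** Carathéodory's form of the derivative: a factorization of the increment by a slope continuous at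
    [t]. Product rules become algebra on slopes, even when one factor is merely continuous, as in
    [cross_is_derive]. *)
Lemma is_derive_slope (V : NormedModule R_AbsRing) (f : R -> V) (t : R) (l : V) :
  is_derive f t l ->
  exists q : R -> V, continuous q t /\ q t = l /\
    forall s, minus (f s) (f t) = scal (s - t) (q s).
Proof.
intros [_ h].
specialize (h t (fun P hP => hP)).
exists (fun s => if Req_EM_T s t then l else scal (/ (s - t)) (minus (f s) (f t))).
assert (e : (if Req_EM_T t t then l else scal (/ (t - t)) (minus (f t) (f t))) = l)
  by (destruct (Req_EM_T t t); [reflexivity | easy]).
split; [| split; [exact e |]].
- apply (proj2 (filterlim_locally_ball_norm _ _)); intros eps.
  rewrite e.
  assert (h' := h (mkposreal _ (is_pos_div_2 eps))); simpl in h'.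
  revert h'; apply filter_imp; intros s hs; unfold ball_norm.
  destruct (Req_EM_T s t) as [-> | n].
  + rewrite norm_minus_self; apply cond_pos.
  + assert (e' : minus (scal (/ (s - t)) (minus (f s) (f t))) l
      = scal (/ (s - t)) (minus (minus (f s) (f t)) (scal (minus s t) l))).
    { symmetry; rewrite (scal_minus_distr_l (V := V) _ (minus (f s) (f t))).
      apply (f_equal (minus _)).
      apply scal_inv_l; intros e0; apply n, Rminus_diag_uniq, e0. }
    apply Rle_lt_trans with (1 := Req_le _ _ (f_equal norm e')).
    apply Rle_lt_trans with (1 := norm_scal_R _ _ _).
    change (Rabs (/ (s - t)) * norm (minus (minus (f s) (f t)) (scal (minus s t) l)) < eps).
    assert (hp : 0 < Rabs (s - t)).
    { apply Rabs_pos_lt; intros e0; apply n, Rminus_diag_uniq, e0. }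
    rewrite Rabs_inv.
    apply Rle_lt_trans with (/ Rabs (s - t) * (eps / 2 * Rabs (s - t))).
    * apply Rmult_le_compat_l; [left; now apply Rinv_0_lt_compat | exact hs].
    * field_simplify; [| lra]. destruct eps; simpl; lra.
- intros s; destruct (Req_EM_T s t) as [-> | n].
  + rewrite Rminus_diag, (minus_eq_zero (G := V)); symmetry.
    apply (scal_zero_l (V := V)).
  + symmetry; apply scal_inv_r; lra.
Qed.

Lemma slope_is_derive (V : NormedModule R_AbsRing) (f q : R -> V) (t : R) :
  (forall s, minus (f s) (f t) = scal (s - t) (q s)) ->
  continuous q t -> is_derive f t (q t).
Proof.
intros hs hq; split; [apply is_linear_scal_l |].
intros x hx; apply (is_filter_lim_locally_unique (V := AbsRing_NormedModule R_AbsRing)) in hx;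
subst x; intros eps.
assert (h := proj1 (filterlim_locally_ball_norm q (q t)) hq eps).
revert h; apply filter_imp; intros s h; unfold ball_norm in h.
rewrite hs.
apply Rle_trans with
  (1 := Req_le _ _ (f_equal norm (eq_sym (scal_minus_distr_l (s - t) (q s) (q t))))).
apply Rle_trans with (1 := norm_scal_R _ _ _).
change (Rabs (s - t) * norm (minus (q s) (q t)) <= eps * Rabs (s - t)).
rewrite Rmult_comm; apply Rmult_le_compat_r; [apply Rabs_pos | lra].
Qed.

(** Kept apart from [HilbertSpace] because the same calculus serves [inner] on [H] and
    [energy_inner] on [energy_space], which is built only as a normed module. *)
Record scalar_product (X : NormedModule R_AbsRing) (b : X -> X -> R) : Prop := {
  sp_sym : forall x y, b x y = b y x;
  sp_plus : forall x y z, b (plus x y) z = b x z + b y z;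
  sp_scal : forall (k : R) x y, b (scal k x) y = k * b x y;
  sp_norm : forall x, b x x = norm x ^ 2
}.

Section ScalarProduct.

Context {X : NormedModule R_AbsRing} {b : X -> X -> R} (hb : scalar_product X b).

Lemma sp_plus_r x y z : b z (plus x y) = b z x + b z y.
Proof. now rewrite (sp_sym _ _ hb), (sp_plus _ _ hb), !(sp_sym _ _ hb z). Qed.

Lemma sp_scal_r (k : R) x z : b z (scal k x) = k * b z x.
Proof. now rewrite (sp_sym _ _ hb), (sp_scal _ _ hb), (sp_sym _ _ hb z). Qed.

Lemma sp_opp x z : b (opp x) z = - b x z.
Proof. 
transitivity (b (scal (- 1) x) z); [| rewrite (sp_scal _ _ hb); ring].
exact (f_equal (fun y => b y z) (eq_sym (scal_opp_one (V := X) x))).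
 Qed.

Lemma sp_minus x y z : b (minus x y) z = b x z - b y z.
Proof. unfold minus; rewrite (sp_plus _ _ hb), sp_opp; ring. Qed.

Lemma sp_minus_r x y z : b z (minus x y) = b z x - b z y.
Proof. now rewrite (sp_sym _ _ hb), sp_minus, !(sp_sym _ _ hb z). Qed.

Lemma sp_cauchy_schwarz x y : Rabs (b x y) <= norm x * norm y.
Proof.
rewrite <- (Rabs_pos_eq (norm x * norm y)).
- apply Rsqr_le_abs_0; unfold Rsqr.
  assert (h : forall k, 0 <= norm x ^ 2 + 2 * k * b x y + k * k * norm y ^ 2).
  { intros k; rewrite <- !(sp_norm _ _ hb).
    assert (h := pow2_ge_0 (norm (plus x (scal k y)))).
    rewrite <- (sp_norm _ _ hb), (sp_plus _ _ hb), !sp_plus_r, !(sp_scal _ _ hb), !sp_scal_r,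
      (sp_sym _ _ hb y x) in h; lra. }
  destruct (Req_dec (norm y) 0) as [e | n].
  + assert (e' : b x y = 0).
    { apply norm_eq_zero in e; rewrite e.
      transitivity (b x (scal 0 x)); [| rewrite sp_scal_r; ring].
      exact (f_equal (b x) (eq_sym (scal_zero_l (V := X) x))). }
    rewrite e, e'; lra.
  + assert (hn : 0 < norm y ^ 2) by (assert (h1 := norm_ge_0 y); nra).
    (* The minimizer in [k] of the quadratic polynomial in [h]. *)
    specialize (h (- b x y / norm y ^ 2)).
    assert (h2 : 0 <= norm x ^ 2 * norm y ^ 2 - b x y ^ 2).
    { replace (norm x ^ 2 * norm y ^ 2 - b x y ^ 2) with
        (norm y ^ 2 * (norm x ^ 2 + 2 * (- b x y / norm y ^ 2) * b x y +
          - b x y / norm y ^ 2 * (- b x y / norm y ^ 2) * norm y ^ 2)) by (field; lra).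
      apply Rmult_le_pos; lra. }
    nra.
- apply Rmult_le_pos; apply norm_ge_0.
Qed.

Lemma continuous_sp (T : UniformSpace) (f g : T -> X) (t : T) :
  continuous f t -> continuous g t -> continuous (fun s => b (f s) (g s)) t.
Proof.
intros hf hg.
apply (continuous_of_norm_bound T R_NormedModule _
  (fun s => norm (minus (f s) (f t)) * norm (g s) + norm (f t) * norm (minus (g s) (g t)))).
- apply filter_forall; intros s.
  change (Rabs (b (f s) (g s) - b (f t) (g t)) <=
    norm (minus (f s) (f t)) * norm (g s) + norm (f t) * norm (minus (g s) (g t))).
  replace (b (f s) (g s) - b (f t) (g t))
    with (b (minus (f s) (f t)) (g s) + b (f t) (minus (g s) (g t)))
    by (rewrite sp_minus, sp_minus_r; ring).
  apply Rle_trans with (1 := Rabs_triang _ _).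
  apply Rplus_le_compat; apply sp_cauchy_schwarz.
- apply (continuous_plus (V := R_NormedModule)); apply (continuous_mult (K := R_AbsRing)).
  + now apply continuous_norm, continuous_minus_const.
  + now apply continuous_norm.
  + apply continuous_const.
  + now apply continuous_norm, continuous_minus_const.
- rewrite !norm_minus_self; ring.
Qed.

Lemma is_derive_sp (f g : R -> X) (t : R) (df dg : X) :
  is_derive f t df -> is_derive g t dg ->
  is_derive (fun s => b (f s) (g s)) t (b df (g t) + b (f t) dg).
Proof.
intros hf hg.
assert (cg : continuous g t) by (apply ex_derive_continuous; now exists dg).
destruct (is_derive_slope _ _ _ _ hf) as [q [hq [<- eq]]].
destruct (is_derive_slope _ _ _ _ hg) as [r [hr [<- er]]].
apply (slope_is_derive R_NormedModule _ (fun s => b (q s) (g s) + b (f t) (r s))).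
- intros s.
  transitivity (b (minus (f s) (f t)) (g s) + b (f t) (minus (g s) (g t))).
  + rewrite sp_minus, sp_minus_r; change (b (f s) (g s) - b (f t) (g t) =
      b (f s) (g s) - b (f t) (g s) + (b (f t) (g s) - b (f t) (g t))); ring.
  + rewrite eq, er, (sp_scal _ _ hb), sp_scal_r; unfold scal; simpl; unfold mult; simpl; ring.
- apply (continuous_plus (V := R_NormedModule)); apply continuous_sp;
    auto using continuous_const.
Qed.

End ScalarProduct.

(** * Groups of exponentials *)

Lemma is_linear_Riemann_sum (U V : NormedModule R_AbsRing) (l : U -> V) (f : R -> U)
  (ptd : SF_seq) :
  is_linear l -> l (Riemann_sum f ptd) = Riemann_sum (fun t => l (f t)) ptd.
Proof.
intros hl; induction ptd as [x | h ptd IH] using SF_cons_ind.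
- exact (linear_zero l hl).
- rewrite !Riemann_sum_cons, <- IH.
  transitivity (plus (l (scal (SF_h ptd - fst h) (f (snd h)))) (l (Riemann_sum f ptd))).
  + apply (linear_plus l hl).
  + apply (f_equal (fun y => plus y _)), (linear_scal l hl).
Qed.

Lemma is_RInt_linear (U V : NormedModule R_AbsRing) (l : U -> V) (f : R -> U)
  (a b : R) (I : U) :
  is_linear l -> is_RInt f a b I -> is_RInt (fun t => l (f t)) a b (l I).
Proof.
intros hl hf.
apply (filterlim_ext (fun ptd => l (scal (sign (b - a)) (Riemann_sum f ptd)))).
- intros ptd; rewrite <- (is_linear_Riemann_sum _ _ _ _ _ hl); apply (linear_scal l hl).
- apply (filterlim_comp _ _ _ _ l _ _ _ hf), (linear_cont l I hl).
Qed.

Lemma graph_scal (E E' : NormedModule R_AbsRing) (T : operator E E') (k : R) x y :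
  graph T x y -> graph T (scal k x) (scal k y).
Proof.
intros [[x' hx] [<- <-]].
exists (exist _ (scal k x') (dom_scal k hx)); split; [reflexivity |].
now apply app_scal.
Qed.

Section ExpGroup.

Context {X : NormedModule R_AbsRing} {T : operator X X} {S : R -> X -> X}
  (hS : is_exp_group T S).

Lemma exp_group_opp t x : S t (S (- t) x) = x.
Proof.
now rewrite <- (exp_group_plus hS), Rplus_opp_r, (exp_group_0 hS).
Qed.

Lemma continuous_shift (f : R -> X) t : continuous f 0 -> continuous (fun s => f (s - t)) t.
Proof.
intros hf; apply (continuous_comp (fun s => s - t) f).
- apply (continuous_minus (V := R_NormedModule)); [apply continuous_id | apply continuous_const].
- now rewrite Rminus_diag.
Qed.

Lemma exp_group_continuous_at x t : continuous (fun s => S s x) t.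
Proof.
apply (continuous_ext (fun s => S t (S (s - t) x))).
- intros s; rewrite <- (exp_group_plus hS); f_equal; ring.
- apply (continuous_comp (fun s => S (s - t) x) (S t)).
  + apply (continuous_shift (fun s => S s x)), (exp_group_continuous hS).
  + apply linear_cont, (exp_group_linear hS).
Qed.

Lemma exp_group_is_derive x y t : graph T x y -> is_derive (fun s => S s x) t (S t y).
Proof.
intros h; apply (exp_group_generator hS) in h.
destruct (is_derive_slope _ _ _ _ h) as [q [hq [eq e]]].
rewrite <- eq; replace (q 0) with (q (t - t)) by (f_equal; ring).
apply (slope_is_derive X _ (fun s => S t (q (s - t)))).
- intros s.
  replace (S s x) with (S t (S (s - t) x))
    by (rewrite <- (exp_group_plus hS); f_equal; ring).
  assert (hl := exp_group_linear hS t).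
  replace (S t x) with (S t (S 0 x)) by (now rewrite (exp_group_0 hS)).
  transitivity (S t (minus (S (s - t) x) (S 0 x))).
  + symmetry; apply (linear_minus _ _ _ hl).
  + rewrite e, Rminus_0_r; apply (linear_scal _ hl).
- apply (continuous_comp (fun s => q (s - t)) (S t)).
  + now apply continuous_shift.
  + apply linear_cont, (exp_group_linear hS).
Qed.

(** The bounded operator [S t] commutes with the group, so it passes through the derivative at 0 of
    the orbit of [x]. *)
Lemma exp_group_graph x y t : graph T x y -> graph T (S t x) (S t y).
Proof.
intros h; apply (exp_group_generator hS).
apply (is_derive_ext (fun s => S t (S s x))).
- intros s; rewrite <- !(exp_group_plus hS); f_equal; ring.
- apply (exp_group_generator hS) in h.
  apply (filterdiff_comp' (fun s => S s x) (S t) 0 (fun h => scal h y) (S t)) in h.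
  + apply (filterdiff_ext_lin _ _ _ h); intros k.
    apply (linear_scal _ (exp_group_linear hS t)).
  + apply filterdiff_linear, (exp_group_linear hS).
Qed.

Section Isometry.

Context {b : X -> X -> R} (hb : scalar_product X b).
Hypothesis skew : forall x y, graph T x y -> b y x = 0.
(** Stands in for completeness of [X]; [energy_integrable] provides it for the energy space. *)
Hypothesis integrable : forall f : R -> X, (forall t, continuous f t) ->
  exists If : R -> X, forall c, is_RInt f 0 c (If c).

(** The squared norm has derivative [2 * b (S s y) (S s x)] along the orbit. Since the orbit stays
    in the domain, [skew] makes this vanish. *)
Lemma exp_group_norm_graph x y t : graph T x y -> norm (S t x) = norm x.
Proof.
intros h.
assert (e : b (S t x) (S t x) = b (S 0 x) (S 0 x)).
{ destruct (MVT_gen (fun t => b (S t x) (S t x)) 0 t (fun _ => 0)) as [c [_ hc]].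
  - intros s _.
    replace 0 with (b (S s y) (S s x) + b (S s x) (S s y)).
    + apply (is_derive_sp hb); now apply exp_group_is_derive.
    + rewrite (sp_sym _ _ hb (S s x)), skew; [ring | now apply exp_group_graph].
  - intros s _; apply continuity_pt_filterlim.
    apply (continuous_sp hb); apply exp_group_continuous_at.
  - lra. }
rewrite !(sp_norm _ _ hb), (exp_group_0 hS) in e.
assert (h1 := norm_ge_0 x); assert (h2 := norm_ge_0 (S t x)); nra.
Qed.

(* The averages of an orbit over short times lie in the domain of the generator. *)
Lemma generator_dense (x : X) (eps : R) : 0 < eps ->
  exists y z, graph T y z /\ norm (minus y x) < eps.
Proof.
intros he.
destruct (integrable (fun t => S t x) (exp_group_continuous_at x)) as [I hI].
assert (dI : forall t, is_derive I t (S t x)).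
{ intros t; apply (is_derive_RInt (fun t => S t x) I 0 t).
  - now apply filter_forall.
  - apply exp_group_continuous_at. }
(* By the group law and a translation of the variable, [S t] maps the integral over [0, h] to
   [I (t + h) - I t], which is differentiable in [t] because [I] is a primitive of the orbit. *)
assert (hg : forall h, graph T (minus (I h) (I 0)) (minus (S h x) (S 0 x))).
{ intros h; apply (exp_group_generator hS).
  apply (is_derive_ext (fun t => minus (I (t + h)) (I (t + 0)))).
  - intros t.
    assert (hc : forall c, is_RInt (fun s => S t (S s x)) 0 c (minus (I (t + c)) (I t))).
    { intros c.
      apply (is_RInt_ext (fun s => scal 1 (S (1 * s + t) x))).
      - intros s _; rewrite (scal_one (V := X)), <- (exp_group_plus hS).
        f_equal; ring.
      - apply (is_RInt_comp_lin (fun s => S s x)).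
        rewrite Rmult_0_r, Rplus_0_l, Rmult_1_l, (Rplus_comm c).
        unfold minus; rewrite plus_comm.
        apply (is_RInt_Chasles _ t 0); [apply is_RInt_swap |]; apply hI. }
    assert (hl := exp_group_linear hS t).
    assert (h1 := is_RInt_linear _ _ _ _ _ _ _ hl (hI h)).
    assert (h0 := is_RInt_linear _ _ _ _ _ _ _ hl (hI 0)).
    assert (e1 := filterlim_locally_unique _ _ _ h1 (hc h)).
    assert (e0 := filterlim_locally_unique _ _ _ h0 (hc 0)).
    symmetry; transitivity (minus (S t (I h)) (S t (I 0))); [apply (linear_minus _ _ _ hl) |].
    rewrite e1, e0.
    rewrite Rplus_0_r, (minus_eq_zero (G := X)).
    apply (minus_zero_r (G := X)).
  - apply (is_derive_minus (V := X)).
    + replace (S h x) with (scal 1 (S (0 + h) x)) by (rewrite Rplus_0_l; apply (scal_one (V := X))).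
      apply (is_derive_comp I (fun t => t + h)); [apply dI |].
      auto_derive; auto.
    + replace (S 0 x) with (scal 1 (S (0 + 0) x)) by (rewrite Rplus_0_l; apply (scal_one (V := X))).
      apply (is_derive_comp I (fun t => t + 0)); [apply dI |].
      auto_derive; auto. }
(* For nonzero [h] the slope [q h] is the average of the orbit over [0, h]: it lies in the domain,
   and it tends to [x] as [h] tends to 0. *)
destruct (is_derive_slope _ _ _ _ (dI 0)) as [q [hq [eq e]]].
assert (hn := proj1 (filterlim_locally_ball_norm q (q 0)) hq (mkposreal eps he)).
destruct hn as [d hd].
assert (hd' := hd (d / 2)); simpl in hd'; unfold ball_norm in hd'.
exists (q (d / 2)), (scal (/ (d / 2)) (minus (S (d / 2) x) (S 0 x))).
assert (hd0 : d / 2 <> 0) by (destruct d; simpl; lra).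
split.
- replace (q (d / 2)) with (scal (/ (d / 2)) (minus (I (d / 2)) (I 0))).
  + apply graph_scal, hg.
  + rewrite e, Rminus_0_r; apply scal_inv_l, hd0.
- rewrite (exp_group_0 hS) in eq; rewrite <- eq; apply hd'.
  change (Rabs (d / 2 - 0) < d); destruct d; simpl in *; rewrite Rabs_pos_eq; lra.
Qed.

Lemma exp_group_norm x t : norm (S t x) = norm x.
Proof.
destruct (linear_norm _ (exp_group_linear hS t)) as [M [M0 hM]].
apply cond_eq; intros eps he.
(* Replacing [x] by [y] costs at most [M * norm (minus y x)] after applying [S t] and
   [norm (minus y x)] before. *)
destruct (generator_dense x (eps / (M + 1))) as [y [z [hy hn]]].
{ apply Rdiv_lt_0_compat; lra. }
assert (e := exp_group_norm_graph y z t hy).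
assert (h1 := norm_triangle_inv (S t y) (S t x)).
rewrite <- (linear_minus _ _ _ (exp_group_linear hS t)) in h1.
assert (h2 := norm_triangle_inv y x); assert (h3 := hM (minus y x)).
apply (Rmult_lt_compat_r (M + 1)) in hn; [| lra].
replace (eps / (M + 1) * (M + 1)) with eps in hn by (field; lra).
rewrite e in h1.
apply Rabs_le_between in h1; apply Rabs_le_between in h2.
apply Rabs_lt_between; lra.
Qed.

(** Polarization of the isometry. *)
Lemma exp_group_sp x y t : b (S t x) (S t y) = b x y.
Proof.
assert (e := exp_group_norm (plus x y) t); assert (ex := exp_group_norm x t);
  assert (ey := exp_group_norm y t).
apply (f_equal (fun r => r ^ 2)) in e, ex, ey.
rewrite (linear_plus _ (exp_group_linear hS t)) in e.
rewrite <- !(sp_norm _ _ hb) in e, ex, ey.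
rewrite !(sp_plus _ _ hb), !(sp_plus_r hb) in e.
rewrite (sp_sym _ _ hb y x), (sp_sym _ _ hb (S t y)) in e; lra.
Qed.

Section Mild.

Context {U f : R -> X}.
Hypothesis f_continuous : forall t, continuous f t.
Hypothesis mild : forall t, 0 <= t -> exists J,
  is_RInt (fun s => S (- (t - s)) (f s)) 0 t J /\ U t = plus (S (- t) (U 0)) J.

(** Applying [S s] to the mild formula removes the outer time from the integrand: [S s (U s)] is
    [U 0] plus the integral of [S r (f r)] over [0, s], and the fundamental theorem of calculus
    applies. *)
Lemma mild_pullback_is_derive t : 0 < t -> is_derive (fun s => S s (U s)) t (S t (f t)).
Proof.
intros ht.
assert (hc : continuous (fun s => S s (f s)) t).
(* The isometry controls the variation of [f] under the moving operator [S s]; strong continuity at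
   the fixed vector [f t] controls the rest. *)
{ apply (continuous_of_norm_bound _ _ _
    (fun s => norm (minus (f s) (f t)) + norm (minus (S s (f t)) (S t (f t))))).
  - apply filter_forall; intros s.
    rewrite (minus_trans (G := X) (S s (f t))).
    apply Rle_trans with (1 := norm_triangle _ _), Rplus_le_compat_r.
    right; rewrite <- (linear_minus _ _ _ (exp_group_linear hS s)).
    apply exp_group_norm.
  - apply (continuous_plus (V := R_NormedModule)); apply continuous_norm, continuous_minus_const.
    + apply f_continuous.
    + apply exp_group_continuous_at.
  - rewrite !norm_minus_self; ring. }
assert (hI : is_derive (fun s => minus (S s (U s)) (U 0)) t (S t (f t))).
{ apply (is_derive_RInt (fun s => S s (f s)) _ 0 t); [| exact hc].
  exists (mkposreal t ht); intros s hs.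
  assert (hs0 : 0 <= s).
  { change (Rabs (s - t) < t) in hs; apply Rabs_lt_between in hs; lra. }
  destruct (mild s hs0) as [J [hJ e]].
  assert (hl := exp_group_linear hS s).
  replace (minus (S s (U s)) (U 0)) with (S s J).
  - apply (is_RInt_ext (fun r => S s (S (- (s - r)) (f r)))).
    + intros r _; rewrite <- (exp_group_plus hS); f_equal; ring.
    + now apply is_RInt_linear.
  - rewrite e, (linear_plus _ hl), exp_group_opp.
    unfold minus; rewrite plus_comm, (plus_assoc (G := X)), (plus_opp_l (G := X)).
    symmetry; apply (plus_zero_l (G := X)). }
apply (is_derive_plus (V := X) _ (fun _ => U 0) _ _ zero) in hI; [| apply is_derive_const].
rewrite plus_zero_r in hI.
apply (is_derive_ext _ _ _ _) with (2 := hI); intros s.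
unfold minus; rewrite <- (plus_assoc (G := X)), (plus_opp_l (G := X)).
apply (plus_zero_r (G := X)).
Qed.

(** The group is inserted in both arguments before differentiating and removed afterwards, so no
    derivative of [U] itself is used. *)
Lemma mild_norm_is_derive t : 0 < t ->
  is_derive (fun s => b (U s) (U s)) t (2 * b (f t) (U t)).
Proof.
intros ht; assert (h := mild_pullback_is_derive t ht).
apply (is_derive_ext (fun s => b (S s (U s)) (S s (U s)))).
- intros s; apply exp_group_sp.
- replace (2 * b (f t) (U t)) with
    (b (S t (f t)) (S t (U t)) + b (S t (U t)) (S t (f t))).
  + now apply (is_derive_sp hb).
  + rewrite !exp_group_sp, (sp_sym _ _ hb (U t)); ring.
Qed.

(** The equation in weak form. The pairing equals that of [S s (U s)] with [S s x], and both curves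
    are differentiable. The generator falls on [x] with a plus sign, as skew-symmetry reverses the
    minus sign of [S (- t)]. *)
Lemma mild_sp_is_derive x y t : 0 < t -> graph T x y ->
  is_derive (fun s => b (U s) x) t (b (f t) x + b (U t) y).
Proof.
intros ht hx; assert (h := mild_pullback_is_derive t ht).
apply (is_derive_ext (fun s => b (S s (U s)) (S s x))).
- intros s; apply exp_group_sp.
- rewrite <- (exp_group_sp (f t) x t), <- (exp_group_sp (U t) y t).
  apply (is_derive_sp hb); [exact h | now apply exp_group_is_derive].
Qed.

End Mild.

End Isometry.

End ExpGroup.

(** * The energy space and the wave operator *)

Lemma inner_scalar_product (H : HilbertSpace) :
  scalar_product H (@inner H).
Proof.
split.
- apply inner_sym.
- apply inner_plus_l.
- apply inner_scal_l.
- intros x; rewrite inner_norm, pow2_sqrt; [reflexivity | apply inner_pos].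
Qed.

Section GraphSpace.

Context {H : HilbertSpace} {B : operator H H}.

Lemma Dom_norm_pow2 (x : Dom B) : norm x ^ 2 = norm (emb x) ^ 2 + norm (B x) ^ 2.
Proof.
change (sqrt (norm (emb x) ^ 2 + norm (B x) ^ 2) ^ 2 = norm (emb x) ^ 2 + norm (B x) ^ 2).
rewrite pow2_sqrt; [reflexivity |].
apply Rplus_le_le_0_compat; apply pow2_ge_0.
Qed.

Lemma Dom_norm_le (x : Dom B) : norm x <= norm (emb x) + norm (B x).
Proof.
assert (e := Dom_norm_pow2 x); assert (h := norm_ge_0 x);
  assert (h1 := norm_ge_0 (emb x)); assert (h2 := norm_ge_0 (B x)); nra.
Qed.

Lemma is_linear_emb : is_linear (emb (T := B) : Dom_NormedModule B -> H).
Proof.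
split; [reflexivity | reflexivity |].
exists 1; split; [lra |]; intros x.
assert (e := Dom_norm_pow2 x); assert (h := norm_ge_0 x);
  assert (h1 := norm_ge_0 (emb x)); assert (h2 := norm_ge_0 (B x)); nra.
Qed.

Lemma is_linear_app : is_linear (fun x : Dom_NormedModule B => B x).
Proof.
split; [apply app_Dom_plus | intros k x; apply app_Dom_scal |].
exists 1; split; [lra |]; intros x.
assert (e := Dom_norm_pow2 x); assert (h := norm_ge_0 x);
  assert (h1 := norm_ge_0 (emb x)); assert (h2 := norm_ge_0 (B x)); nra.
Qed.

Lemma is_RInt_Dom (f : R -> Dom B) (a b : R) (l : Dom B) :
  is_RInt (fun t => emb (f t)) a b (emb l) -> is_RInt (fun t => B (f t)) a b (B l) ->
  is_RInt f a b l.
Proof.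
intros h1 h2.
assert (hF : Filter (Riemann_fine a b)) by apply _.
apply (proj2 (filterlim_locally_ball_norm _ l)); intros eps.
assert (h1' := proj1 (filterlim_locally_ball_norm _ (emb l)) h1 (mkposreal _ (is_pos_div_2 eps))).
assert (h2' := proj1 (filterlim_locally_ball_norm _ (B l)) h2 (mkposreal _ (is_pos_div_2 eps))).
generalize (filter_and _ _ h1' h2'); apply filter_imp; clear h1' h2'.
unfold ball_norm; simpl; intros ptd [h3 h4].
apply Rle_lt_trans with (1 := Dom_norm_le _).
assert (e1 := is_linear_Riemann_sum _ _ _ f ptd is_linear_emb).
assert (e2 := is_linear_Riemann_sum _ _ _ f ptd is_linear_app).
rewrite <- e1 in h3; rewrite <- e2 in h4.
rewrite <- (linear_scal _ is_linear_emb), <- (linear_minus _ _ _ is_linear_emb) in h3.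
rewrite <- (linear_scal _ is_linear_app), <- (linear_minus _ _ _ is_linear_app) in h4.
replace (pos eps) with (eps / 2 + eps / 2) by field.
exact (Rplus_lt_compat _ _ _ _ h3 h4).
Qed.

Hypothesis B_self_adjoint : self_adjoint B.

Lemma self_adjoint_symmetric (x y : Dom B) : inner (B x) (emb y) = inner (emb x) (B y).
Proof.
apply (proj2 (self_adjoint_graph B_self_adjoint (emb y) (B y))).
now exists y.
Qed.

Lemma is_linear_inner (x : H) : is_linear (fun y : H => inner x y : R_NormedModule).
Proof.
assert (hi := inner_scalar_product H).
split.
- intros y z; apply (sp_plus_r hi).
- intros k y; apply (sp_scal_r hi).
- exists (norm x + 1); assert (hx := norm_ge_0 x); split; [lra |].
  intros y; apply Rle_trans with (1 := sp_cauchy_schwarz hi x y).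
  assert (hy := norm_ge_0 y); nra.
Qed.

(** Closedness of [B], read off the adjoint: testing against a fixed [x] of the domain commutes with
    the integral, and [B] is symmetric under it, so the pair of integrals satisfies the identity
    that characterizes the graph. *)
Lemma self_adjoint_integral (f : R -> Dom B) (a b : R) (v w : H) :
  is_RInt (fun t => emb (f t)) a b v -> is_RInt (fun t => B (f t)) a b w -> graph B v w.
Proof.
intros hv hw; apply (self_adjoint_graph B_self_adjoint); intros x.
assert (h1 := is_RInt_linear _ _ _ _ _ _ _ (is_linear_inner (B x)) hv).
assert (h2 := is_RInt_linear _ _ _ _ _ _ _ (is_linear_inner (emb x)) hw).
apply (filterlim_locally_unique _ _ _ h1).
apply (is_RInt_ext _ _ _ _ _) with (2 := h2).
intros t _; symmetry; apply self_adjoint_symmetric.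
Qed.

Lemma Dom_integrable (f : R -> Dom B) : (forall t, continuous f t) ->
  exists If : R -> Dom B, forall c, is_RInt f 0 c (If c).
Proof.
intros hf.
assert (h1 : forall c, is_RInt (fun t => emb (f t)) 0 c (RInt (fun t => emb (f t)) 0 c)).
{ intros c; apply (RInt_correct (V := H)), (ex_RInt_continuous (V := H)); intros t _.
  apply (continuous_comp f (emb (T := B))); [apply hf |].
  exact (linear_cont _ (f t) is_linear_emb). }
assert (h2 : forall c, is_RInt (fun t => B (f t)) 0 c (RInt (fun t => B (f t)) 0 c)).
{ intros c; apply (RInt_correct (V := H)), (ex_RInt_continuous (V := H)); intros t _.
  apply (continuous_comp f (fun x : Dom B => B x)); [apply hf |].
  exact (linear_cont _ (f t) is_linear_app). }
assert (hg := fun c => self_adjoint_integral f 0 c _ _ (h1 c) (h2 c)).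
assert (hd : forall c, dom B (RInt (fun t => emb (f t)) 0 c)).
{ intros c; destruct (hg c) as [[x hx] [e _]]; now rewrite <- e. }
exists (fun c => exist _ _ (hd c)); intros c.
apply is_RInt_Dom; [apply h1 |].
destruct (hg c) as [x [e1 e2]].
replace (exist _ _ (hd c)) with x by now apply Dom_eq.
rewrite e2; apply h2.
Qed.

(** Polarizes the product norm with the full graph norm on the first factor; the term in
    [emb (fst U)] is matched by the [+ u] in the wave operator. *)
Definition energy_inner (U V : energy_space B) : R :=
  inner (emb (fst U)) (emb (fst V)) + inner (B (fst U)) (B (fst V)) + inner (snd U) (snd V).

Lemma energy_scalar_product : scalar_product (energy_space B) energy_inner.
Proof.
assert (hi := inner_scalar_product H).
unfold energy_inner; split.
- intros x y; now rewrite (inner_sym (emb (fst x))), (inner_sym (B (fst x))), (inner_sym (snd x)).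
- intros x y z.
  change (inner (plus (emb (fst x)) (emb (fst y))) (emb (fst z))
    + inner (B (plus (fst x) (fst y))) (B (fst z))
    + inner (plus (snd x) (snd y)) (snd z) =
    inner (emb (fst x)) (emb (fst z)) + inner (B (fst x)) (B (fst z)) + inner (snd x) (snd z) +
    (inner (emb (fst y)) (emb (fst z)) + inner (B (fst y)) (B (fst z)) + inner (snd y) (snd z))).
  rewrite app_Dom_plus, !inner_plus_l; ring.
- intros k x z.
  change (inner (scal k (emb (fst x))) (emb (fst z))
    + inner (B (scal k (fst x))) (B (fst z))
    + inner (scal k (snd x)) (snd z) =
    k * (inner (emb (fst x)) (emb (fst z)) + inner (B (fst x)) (B (fst z)) + inner (snd x) (snd z))).
  rewrite app_Dom_scal, !inner_scal_l; ring.
- intros x.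
  change (inner (emb (fst x)) (emb (fst x)) + inner (B (fst x)) (B (fst x)) + inner (snd x) (snd x)
    = sqrt (norm (fst x) ^ 2 + norm (snd x) ^ 2) ^ 2).
  rewrite pow2_sqrt by (apply Rplus_le_le_0_compat; apply pow2_ge_0).
  now rewrite Dom_norm_pow2, !(sp_norm _ _ hi).
Qed.

Lemma energy_integrable (f : R -> energy_space B) : (forall t, continuous f t) ->
  exists If : R -> energy_space B, forall c, is_RInt f 0 c (If c).
Proof.
intros hf.
destruct (Dom_integrable (fun t => fst (f t))) as [I hI].
{ intros t; apply (continuous_comp f fst); [apply hf | apply continuous_fst]. }
exists (fun c => (I c, RInt (fun t => snd (f t)) 0 c)); intros c.
apply (is_RInt_fct_extend_pair (U := Dom_NormedModule B) (V := H) f); [apply hI |].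
apply (RInt_correct (V := H)), (ex_RInt_continuous (V := H)); intros t _.
apply (continuous_comp f snd); [apply hf | apply continuous_snd].
Qed.

Context {A : operator H H}.
Hypothesis A_square : forall u w : H,
  graph A u w <-> exists v : H, graph B u v /\ graph B v w.

(** As A = B o B and [B] is symmetric, <Au, v> = <Bu, Bv>; the two pairs of terms then cancel. *)
Lemma wave_operator_skew (U V : energy_space B) :
  graph (wave_operator A B) U V -> energy_inner V U = 0.
Proof.
intros [[[u v] hU] [e <-]]; unfold emb in e; simpl in e; subst U.
assert (hi := inner_scalar_product H).
set (uA := exist _ (emb u) (proj1 hU) : Dom A).
set (vB := exist _ v (proj2 hU) : Dom B).
change (inner (emb (opp vB)) (emb u) + inner (B (opp vB)) (B u)
  + inner (plus (A uA) (emb u)) (emb vB) = 0).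
rewrite (linear_opp _ _ is_linear_emb), (linear_opp _ _ is_linear_app).
rewrite !(sp_opp hi), inner_plus_l.
assert (e : inner (A uA) (emb vB) = inner (B u) (B vB)).
{ destruct (proj1 (A_square (emb u) (A uA))) as [w [[u' [e1 e2]] [w' [e3 e4]]]].
  - now exists uA.
  - apply Dom_eq in e1; subst u'.
    now rewrite <- e4, self_adjoint_symmetric, e3, e2. }
rewrite e, (inner_sym (B vB)), (inner_sym (emb vB)); ring.
Qed.

(** Makes (0, w) an admissible test vector: pairing the solution with it extracts <u', w> for [w] in
    D(B). *)
Lemma wave_operator_velocity (w : Dom B) :
  graph (wave_operator A B) (zero, emb w) (opp w, zero).
Proof.
assert (hd : wave_dom A (zero, emb w)) by (split; [apply dom_zero | exact (proj2_sig w)]).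
exists (exist _ _ hd); split; [reflexivity |].
apply injective_projections; simpl.
- now apply Dom_eq.
- transitivity (plus (scal 0 (A (exist _ zero (proj1 hd)))) zero : H).
  + apply (f_equal (fun x => plus x _)), app_scal; simpl.
    symmetry; apply (scal_zero_l (V := H)).
  + rewrite plus_zero_r; apply (scal_zero_l (V := H)).
Qed.

End GraphSpace.

(** * Energy identities *)

(** Clearing the denominator in [is_gradient] lets the estimate include [y = x]. The neighbourhood
    is one for the graph norm, while the error is measured in [H]. *)
Lemma gradient_estimate (H : HilbertSpace) (B : operator H H) (F : Dom B -> R)
  (gradF : Dom B -> H) (x : Dom B) (eps : R) :
  is_gradient F gradF -> 0 < eps ->
  locally x (fun y => Rabs (F y - F x - inner (gradF x) (minus (emb y) (emb x)))
    <= eps * norm (minus (emb y) (emb x))).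
Proof.
intros hF he.
assert (h := proj1 (filterlim_locally _ 0) (hF x) (mkposreal eps he)).
destruct h as [d hd].
exists d; intros y hy.
set (v := minus y x : Dom B).
assert (ev : minus (emb y) (emb x) = emb v)
  by (symmetry; apply (linear_minus _ _ _ is_linear_emb)).
assert (ey : y = plus x v).
{ unfold v, minus; rewrite plus_comm, <- (plus_assoc (G := Dom_AbelianMonoid B)).
  rewrite (plus_opp_l (G := Dom_AbelianGroup B)); symmetry; apply plus_zero_r. }
rewrite ev; destruct (classic (v = zero)) as [e | n].
- rewrite ey, e, plus_zero_r.
  replace (inner (gradF x) (emb zero)) with 0.
  + rewrite Rminus_diag, Rminus_0_r, Rabs_R0.
    apply Rmult_le_pos; [lra | apply norm_ge_0].
  + symmetry; exact (linear_zero _ (is_linear_inner (gradF x))).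
- assert (h := hd v); unfold ball_norm in h.
  assert (hv : 0 < norm (emb v)).
  { destruct (Rle_lt_or_eq_dec _ _ (norm_ge_0 (emb v))) as [p | e]; [exact p | exfalso].
    apply n; apply Dom_eq; symmetry in e; apply norm_eq_zero in e; exact e. }
  assert (hb : ball (zero : Dom B) d v).
  { apply Rle_lt_trans with (Dom_norm v); [| exact hy].
    right; apply f_equal, (minus_zero_r (G := Dom_AbelianGroup B)). }
  specialize (h hb n).
  change (Rabs ((F (plus x v) - F x - inner (gradF x) (emb v)) / norm (emb v) - 0) < eps) in h.
  rewrite <- ey, Rminus_0_r in h; unfold Rdiv in h; rewrite Rabs_mult, Rabs_inv in h.
  rewrite (Rabs_pos_eq (norm (emb v))) in h by lra.
  apply (Rmult_lt_compat_r (norm (emb v))) in h; [| exact hv].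
  rewrite Rmult_assoc, Rinv_l, Rmult_1_r in h by lra; lra.
Qed.

Lemma gradient_continuous (H : HilbertSpace) (B : operator H H) (F : Dom B -> R)
  (gradF : Dom B -> H) (x : Dom B) :
  is_gradient F gradF -> continuous F x.
Proof.
intros hF.
apply (continuous_of_norm_bound _ R_NormedModule F
  (fun y => (1 + norm (gradF x)) * norm (minus (emb y) (emb x)))).
- generalize (gradient_estimate _ _ _ _ x 1 hF Rlt_0_1); apply filter_imp; intros y hy.
  change (Rabs (F y - F x) <= (1 + norm (gradF x)) * norm (minus (emb y) (emb x))).
  assert (hc := sp_cauchy_schwarz (inner_scalar_product H) (gradF x) (minus (emb y) (emb x))).
  apply Rabs_le_between in hy; apply Rabs_le_between in hc; apply Rabs_le_between; lra.
- apply (continuous_mult (K := R_AbsRing)); [apply continuous_const |].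
  apply continuous_norm, continuous_minus_const.
  exact (linear_cont _ x is_linear_emb).
- rewrite norm_minus_self; ring.
Qed.

(* The remainder in the gradient is small against the norm of [H], in which the
   curve is differentiable; continuity for the graph norm is enough. *)
Lemma gradient_is_derive (H : HilbertSpace) (B : operator H H) (F : Dom B -> R)
  (gradF : Dom B -> H) (u : R -> Dom B) (t : R) (v : H) :
  is_gradient F gradF -> continuous u t -> is_derive (fun s => emb (u s)) t v ->
  is_derive (fun s => F (u s)) t (inner (gradF (u t)) v).
Proof.
intros hF hu hd.
assert (hi := inner_scalar_product H).
destruct (is_derive_slope _ _ _ _ hd) as [q [hq [eq e]]].
(* The remainder quotient. At [s = t] the numerator vanishes, so [r t = 0] whatever the value of
   [/ 0]. *)
set (r := fun s => (F (u s) - F (u t) -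
  inner (gradF (u t)) (minus (emb (u s)) (emb (u t)))) / (s - t)).
assert (hr : r t = 0).
{ unfold r; rewrite e, (sp_scal_r hi); unfold Rdiv; rewrite !Rminus_diag; ring. }
replace (inner (gradF (u t)) v) with (r t + inner (gradF (u t)) (q t))
  by (rewrite hr, eq; ring).
apply (slope_is_derive R_NormedModule _ (fun s => r s + inner (gradF (u t)) (q s))).
- intros s; change (F (u s) - F (u t) = (s - t) * (r s + inner (gradF (u t)) (q s))).
  destruct (Req_dec s t) as [-> | n]; [rewrite !Rminus_diag; ring |].
  unfold r; rewrite e, (sp_scal_r hi); field; lra.
- apply (continuous_plus (V := R_NormedModule)).
  + apply (proj2 (filterlim_locally _ _)); intros eps.
    (* Near [t] the slope [q] has norm below [norm v + 1], so this choice of tolerance keeps the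
       quotient below [eps]. *)
    assert (hM : 0 < norm v + 2) by (assert (h := norm_ge_0 v); lra).
    assert (he : 0 < eps / (norm v + 2)) by (apply Rdiv_lt_0_compat; [apply cond_pos | lra]).
    assert (h1 := hu _ (gradient_estimate _ _ _ _ (u t) _ hF he)).
    assert (h2 := proj1 (filterlim_locally_ball_norm q (q t)) hq (mkposreal 1 Rlt_0_1)).
    unfold filtermap in h1.
    generalize (filter_and (F := locally t) _ _ h1 h2); apply filter_imp; clear h1 h2.
    intros s [h1 h2]; unfold ball_norm in h2; simpl in h2.
    change (Rabs (r s - r t) < eps); rewrite hr, Rminus_0_r.
    destruct (Req_dec s t) as [-> | n]; [rewrite hr, Rabs_R0; apply cond_pos |].
    assert (hp : 0 < Rabs (s - t)) by (apply Rabs_pos_lt; lra).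
    unfold r, Rdiv; rewrite Rabs_mult, Rabs_inv.
    apply Rle_lt_trans with
      ((eps / (norm v + 2) * norm (minus (emb (u s)) (emb (u t)))) * / Rabs (s - t)).
    { apply Rmult_le_compat_r; [left; now apply Rinv_0_lt_compat | exact h1]. }
    rewrite e.
    apply Rle_lt_trans with ((eps / (norm v + 2) * (Rabs (s - t) * norm (q s))) * / Rabs (s - t)).
    { apply Rmult_le_compat_r; [left; now apply Rinv_0_lt_compat |].
      apply Rmult_le_compat_l; [lra | apply norm_scal_R]. }
    replace (eps / (norm v + 2) * (Rabs (s - t) * norm (q s)) * / Rabs (s - t))
      with (eps / (norm v + 2) * norm (q s)) by (field; lra).
    assert (h3 := norm_triangle_inv (q s) (q t)).
    apply Rabs_le_between in h3; rewrite eq in h3, h2.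
    apply Rlt_le_trans with (eps / (norm v + 2) * (norm v + 2)).
    { apply Rmult_lt_compat_l; lra. }
    right; field; lra.
  + apply (continuous_sp hi); [apply continuous_const | exact hq].
Qed.

Lemma locally_lipschitz_continuous (X Y : NormedModule R_AbsRing) (g : X -> Y)
  (L : R * R -> R) (x : X) :
  bounded_on_bounded_sets L ->
  (forall u v, norm (minus (g u) (g v)) <= L (norm u, norm v) * norm (minus u v)) ->
  continuous g x.
Proof.
intros hL hg.
(* For [y] within distance 1 of [x], the pair of norms has Euclidean norm at most
   [norm x + (norm x + 1)]. *)
destruct (hL (2 * norm x + 1)) as [C hC].
apply (continuous_of_norm_bound _ _ g (fun y => C * norm (minus y x))).
- generalize (locally_le_locally_norm x _ (locally_norm_ball_norm x (mkposreal 1 Rlt_0_1))).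
  apply filter_imp; intros y hy; unfold ball_norm in hy; simpl in hy.
  apply Rle_trans with (1 := hg y x), Rmult_le_compat_r; [apply norm_ge_0 |].
  apply Rle_trans with (1 := Rle_abs _), hC.
  assert (h := norm_triangle_inv y x); apply Rabs_le_between in h.
  assert (hx := norm_ge_0 x); assert (hy0 := norm_ge_0 y).
  change (sqrt (Rabs (norm y) ^ 2 + Rabs (norm x) ^ 2) <= 2 * norm x + 1).
  rewrite !Rabs_pos_eq by assumption.
  rewrite <- (sqrt_pow2 (2 * norm x + 1)) by lra.
  apply sqrt_le_1_alt; nra.
- apply (continuous_mult (K := R_AbsRing)); [apply continuous_const |].
  apply continuous_norm, continuous_minus_const, continuous_id.
- rewrite norm_minus_self; ring.
Qed.

Lemma continuous_pair (T V W : UniformSpace) (f : T -> V) (g : T -> W) (t : T) :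
  continuous f t -> continuous g t -> continuous (fun s => (f s, g s)) t.
Proof.
intros hf hg; apply (proj2 (filterlim_locally _ _)); intros eps.
exact (filter_and (F := locally t) _ _ (proj1 (filterlim_locally _ _) hf eps)
  (proj1 (filterlim_locally _ _) hg eps)).
Qed.

Section Energy.

Context {H : HilbertSpace} {A B : operator H H}.
Hypothesis B_sqrt : is_sqrt_operator A B.
Context {gradF : Dom B -> H} {F : Dom B -> R}.
Hypothesis F_gradient : is_gradient F gradF.
Hypothesis gradF_continuous : forall x, continuous gradF x.
Context {u : R -> Dom B} {du : R -> H}.
Hypothesis u_continuous : forall t, continuous u t.
Hypothesis du_continuous : forall t, continuous du t.
Hypothesis u_is_derive : forall t, 0 < t -> is_derive (fun s => emb (u s)) t (du t).
Context {S : R -> energy_space B -> energy_space B}.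
Hypothesis S_group : is_exp_group (wave_operator A B) S.
Hypothesis u_mild : forall t, 0 <= t -> exists J : energy_space B,
  is_RInt (fun s => S (- (t - s)) (forcing gradF (u s, du s))) 0 t J /\
  (u t, du t) = plus (S (- t) (u 0, du 0)) J.

Let U (t : R) : energy_space B := (u t, du t).

Lemma forcing_continuous t : continuous (fun s => forcing gradF (U s)) t.
Proof.
apply (continuous_pair _ (Dom_UniformSpace B) H (fun _ => zero : Dom B)
  (fun s => minus (minus (emb (u s)) (gradF (u s))) (du s))).
- apply continuous_const.
- apply (continuous_minus (V := H)); [| apply du_continuous].
  apply (continuous_minus (V := H)).
  + apply (continuous_comp u (emb (T := B))); [apply u_continuous |].
    exact (linear_cont _ (u t) is_linear_emb).
  + apply (continuous_comp u gradF); auto.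
Qed.

Let skew := wave_operator_skew (sqrt_self_adjoint B_sqrt) (Defs.sqrt_square B_sqrt).
Let integrable := energy_integrable (sqrt_self_adjoint B_sqrt).

Lemma pow2_norm_is_derive t : 0 < t ->
  is_derive (fun s => norm (emb (u s)) ^ 2) t (2 * inner (du t) (emb (u t))).
Proof.
intros ht; assert (hi := inner_scalar_product H).
apply (is_derive_ext (fun s => inner (emb (u s)) (emb (u s)))).
- intros s; apply (sp_norm _ _ hi).
- replace (2 * inner (du t) (emb (u t))) with
    (inner (du t) (emb (u t)) + inner (emb (u t)) (du t))
    by (rewrite (inner_sym (emb (u t))); ring).
  apply (is_derive_sp hi); now apply u_is_derive.
Qed.

(** The energy norm also contains |u|^2. Subtracting its derivative 2<u',u> cancels exactly the [u]
    in [forcing] that offsets the [+ u] of the wave operator. *)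
Lemma linear_energy_is_derive t : 0 < t ->
  is_derive (fun s => norm (du s) ^ 2 + norm (B (u s)) ^ 2) t
    (- 2 * (inner (gradF (u t)) (du t) + norm (du t) ^ 2)).
Proof.
intros ht; assert (hi := inner_scalar_product H).
assert (h := mild_norm_is_derive S_group energy_scalar_product skew integrable
  forcing_continuous u_mild t ht).
apply (is_derive_ext (fun s => minus (energy_inner (U s) (U s)) (norm (emb (u s)) ^ 2))).
- intros s; unfold energy_inner, U; simpl fst; simpl snd.
  rewrite !(sp_norm _ _ hi); unfold minus, plus, opp; simpl; ring.
- replace (- 2 * (inner (gradF (u t)) (du t) + norm (du t) ^ 2)) with
    (minus (2 * energy_inner (forcing gradF (U t)) (U t)) (2 * inner (du t) (emb (u t)))).
  + apply (is_derive_minus (V := R_NormedModule)); [exact h | now apply pow2_norm_is_derive].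
  + change (2 * (inner (emb (Dom_zero B)) (emb (u t)) + inner (B (Dom_zero B)) (B (u t)) +
      inner (minus (minus (emb (u t)) (gradF (u t))) (du t)) (du t))
      - 2 * inner (du t) (emb (u t)) = - 2 * (inner (gradF (u t)) (du t) + norm (du t) ^ 2)).
    rewrite (linear_zero _ is_linear_emb : emb (Dom_zero B) = zero).
    rewrite (linear_zero _ is_linear_app : B (Dom_zero B) = zero).
    rewrite !(sp_minus hi), <- (sp_norm _ _ hi), (inner_sym (du t) (emb (u t))).
    assert (e0 : forall x : H, inner zero x = 0).
    { intros x; rewrite (inner_sym zero x); exact (linear_zero _ (is_linear_inner x)). }
    rewrite !e0; ring.
Qed.

Lemma energy_is_derive t : 0 < t ->
  is_derive (fun s => (norm (du s) ^ 2 + norm (B (u s)) ^ 2) / 2 + F (u s)) t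
    (- norm (du t) ^ 2).
Proof.
intros ht.
assert (h1 := linear_energy_is_derive t ht).
assert (h2 := gradient_is_derive _ _ _ _ u t _ F_gradient (u_continuous t) (u_is_derive t ht)).
apply (is_derive_ext (fun s => plus (scal (/ 2) (norm (du s) ^ 2 + norm (B (u s)) ^ 2)) (F (u s)))).
- intros s; unfold plus, scal; simpl; unfold mult; simpl; field.
- replace (- norm (du t) ^ 2) with
   (plus (scal (/ 2) (- 2 * (inner (gradF (u t)) (du t) + norm (du t) ^ 2)))
     (inner (gradF (u t)) (du t)))
    by (unfold plus, scal; simpl; unfold mult; simpl; field).
  apply (is_derive_plus (V := R_NormedModule)); [| exact h2].
  now apply (is_derive_scal (fun s => norm (du s) ^ 2 + norm (B (u s)) ^ 2)).
Qed.

(* [u'] is not differentiable in [H]: its increment is tested against the fixed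
   vector [u t] of [D(B)], for which the equation holds in the weak sense. *)
Lemma cross_is_derive t : 0 < t ->
  is_derive (fun s => inner (du s) (emb (u s))) t
    (norm (du t) ^ 2 - norm (B (u t)) ^ 2 - inner (gradF (u t)) (emb (u t))
     - inner (du t) (emb (u t))).
Proof.
intros ht; assert (hi := inner_scalar_product H).
assert (hw : is_derive (fun s => inner (du s) (emb (u t))) t
  (- norm (B (u t)) ^ 2 - inner (gradF (u t)) (emb (u t)) - inner (du t) (emb (u t)))).
{ assert (h := mild_sp_is_derive S_group energy_scalar_product skew integrable
    forcing_continuous u_mild _ _ t ht (wave_operator_velocity (u t))).
  assert (e0 : forall x : H, inner x zero = 0).
  { intros x; exact (linear_zero _ (is_linear_inner x)). }
  apply (is_derive_ext (fun s => energy_inner (U s) (zero, emb (u t)))).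
  - intros s.
    change (inner (emb (u s)) (emb (Dom_zero B)) + inner (B (u s)) (B (Dom_zero B))
      + inner (du s) (emb (u t)) = inner (du s) (emb (u t))).
    rewrite (linear_zero _ is_linear_emb : emb (Dom_zero B) = zero).
    rewrite (linear_zero _ is_linear_app : B (Dom_zero B) = zero), !e0; ring.
  - replace (- norm (B (u t)) ^ 2 - inner (gradF (u t)) (emb (u t)) - inner (du t) (emb (u t)))
      with (energy_inner (forcing gradF (U t)) (zero, emb (u t))
        + energy_inner (U t) (opp (u t), zero)); [exact h |].
    change (inner (emb (Dom_zero B)) (emb (Dom_zero B)) + inner (B (Dom_zero B)) (B (Dom_zero B))
      + inner (minus (minus (emb (u t)) (gradF (u t))) (du t)) (emb (u t))
      + (inner (emb (u t)) (emb (opp (u t))) + inner (B (u t)) (B (opp (u t))) + inner (du t) zero)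
      = - norm (B (u t)) ^ 2 - inner (gradF (u t)) (emb (u t)) - inner (du t) (emb (u t))).
    rewrite (linear_zero _ is_linear_emb : emb (Dom_zero B) = zero).
    rewrite (linear_zero _ is_linear_app : B (Dom_zero B) = zero), !e0.
    rewrite (linear_opp _ (u t) is_linear_emb : emb (opp (u t)) = opp (emb (u t))).
    rewrite (linear_opp _ (u t) is_linear_app : B (opp (u t)) = opp (B (u t))).
    rewrite !(sp_minus hi), (inner_sym (emb (u t)) (opp _)), (inner_sym (B (u t)) (opp _)).
    rewrite !(sp_opp hi), <- (sp_norm _ _ hi); ring. }
destruct (is_derive_slope _ _ _ _ (u_is_derive t ht)) as [q [hq [eq e]]].
destruct (is_derive_slope R_NormedModule _ _ _ hw) as [r [hr [er e']]].
replace (norm (du t) ^ 2 - norm (B (u t)) ^ 2 - inner (gradF (u t)) (emb (u t))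
  - inner (du t) (emb (u t))) with (inner (du t) (q t) + r t)
  by (rewrite eq, er, (sp_norm _ _ hi); ring).
(* The increment splits as <u'(s), u(s) - u(t)> + <u'(s) - u'(t), u(t)>: the first part needs only
   continuity of [du], the second is [hw]. *)
apply (slope_is_derive R_NormedModule _ (fun s => inner (du s) (q s) + r s)).
- intros s; specialize (e' s); specialize (e s).
  change (inner (du s) (emb (u t)) - inner (du t) (emb (u t)) = (s - t) * r s) in e'.
  change (inner (du s) (emb (u s)) - inner (du t) (emb (u t)) =
    (s - t) * (inner (du s) (q s) + r s)).
  rewrite Rmult_plus_distr_l, <- e', <- (sp_scal_r hi), <- e, (sp_minus_r hi); ring.
- apply (continuous_plus (V := R_NormedModule)); [| exact hr].
  apply (continuous_sp hi); [apply du_continuous | exact hq].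
Qed.

(** Derivatives are available for positive times only; continuity up to 0 lets the mean value
    argument start there. *)
Lemma energy_continuous t :
  continuous (fun s => (norm (du s) ^ 2 + norm (B (u s)) ^ 2) / 2 + F (u s)) t.
Proof.
assert (hi := inner_scalar_product H).
apply (continuous_plus (V := R_NormedModule)).
- apply (continuous_ext (fun s => (inner (du s) (du s) + inner (B (u s)) (B (u s))) * / 2)).
  { intros s; now rewrite !(sp_norm _ _ hi). }
  apply (continuous_mult (K := R_AbsRing)); [| apply continuous_const].
  assert (hB : continuous (fun s => B (u s)) t).
  { apply (continuous_comp u (fun x : Dom B => B x)); [apply u_continuous |].
    exact (linear_cont _ (u t) is_linear_app). }
  apply (continuous_plus (V := R_NormedModule)); apply (continuous_sp hi); auto.
- apply (continuous_comp u F); [apply u_continuous |].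
  now apply gradient_continuous with (1 := F_gradient).
Qed.

Lemma lyapunov_continuous t :
  continuous (fun s => inner (du s) (emb (u s)) + norm (emb (u s)) ^ 2 / 2) t.
Proof.
assert (hi := inner_scalar_product H).
assert (hu : continuous (fun s => emb (u s)) t).
{ apply (continuous_comp u (emb (T := B))); [apply u_continuous |].
  exact (linear_cont _ (u t) is_linear_emb). }
apply (continuous_plus (V := R_NormedModule)); [now apply (continuous_sp hi) |].
apply (continuous_ext (fun s => inner (emb (u s)) (emb (u s)) * / 2)).
{ intros s; now rewrite (sp_norm _ _ hi). }
apply (continuous_mult (K := R_AbsRing)); [| apply continuous_const].
now apply (continuous_sp hi).
Qed.

End Energy.

(** * Decay of a Lyapunov function *)

Lemma increment_le (f df : R -> R) (m a b : R) :
  a <= b -> (forall t, a < t < b -> is_derive f t (df t)) ->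
  (forall t, a < t < b -> df t <= m) -> (forall t, a <= t <= b -> continuous f t) ->
  f b - f a <= m * (b - a).
Proof.
intros hab hd hm hc.
(* The mean value point may be an end point, where nothing is known of [df]. The truncation agrees
   with [df] inside and is at most [m] everywhere. *)
destruct (MVT_gen f a b (fun t => Rmin (df t) m)) as [c [_ e]].
- intros t; rewrite Rmin_left, Rmax_right by exact hab; intros ht.
  rewrite Rmin_left by now apply hm.
  now apply hd.
- intros t; rewrite Rmin_left, Rmax_right by exact hab; intros ht.
  now apply continuity_pt_filterlim, hc.
- rewrite e; apply Rmult_le_compat_r; [lra | apply Rmin_r].
Qed.

Lemma is_derive_Rpower (x a : R) :
  0 < x -> is_derive (fun y => Rpower y a) x (a * Rpower x (a - 1)).
Proof. intros hx; now apply is_derive_Reals, derivable_pt_lim_power. Qed.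

Lemma Rpower_pos (x a : R) : 0 < Rpower x a.
Proof. apply exp_pos. Qed.

Section Decay.

Context {E Phi dE dPhi : R -> R} {p delta kappa : R}.
Hypotheses (p_pos : 0 < p) (delta_pos : 0 < delta) (kappa_pos : 0 < kappa).
Hypothesis E_continuous : forall t, continuous E t.
Hypothesis Phi_continuous : forall t, continuous Phi t.
Hypothesis E_is_derive : forall t, 0 < t -> is_derive E t (dE t).
Hypothesis Phi_is_derive : forall t, 0 < t -> is_derive Phi t (dPhi t).
Hypothesis dE_le : forall t, 0 < t -> dE t <= 0.
Hypothesis dPhi_le : forall t, 0 < t -> dPhi t <= - delta * E t.
Hypothesis E_ge : forall t, 0 <= t -> 0 <= E t.

Lemma E_nonincreasing s t : 0 <= s -> s <= t -> E t <= E s.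
Proof.
intros hs hst.
assert (h : E t - E s <= 0 * (t - s)).
{ apply (increment_le E dE); [exact hst | | | auto]; intros r hr.
  - apply E_is_derive; lra.
  - apply dE_le; lra. }
lra.
Qed.

Lemma Phi_increment s t : 0 <= s -> s <= t -> Phi t - Phi s <= - delta * E t * (t - s).
Proof.
intros hs hst.
apply (increment_le Phi dPhi); [exact hst | | | auto]; intros r hr.
- apply Phi_is_derive; lra.
- assert (h := dPhi_le r ltac:(lra)).
  assert (h' := E_nonincreasing r t ltac:(lra) ltac:(lra)).
  nra.
Qed.

Lemma Phi_nonincreasing s t : 0 <= s -> s <= t -> Phi t <= Phi s.
Proof.
intros hs hst; assert (h := Phi_increment s t hs hst).
assert (h' := E_ge t ltac:(lra)).
assert (0 <= delta * E t * (t - s)) by (repeat apply Rmult_le_pos; lra).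
lra.
Qed.

(** Restricted to positive values because [Rpower 0 a = 1], which would make the inequality false
    for a solution at rest. *)
Hypothesis Phi_le_E : forall t, 0 <= t -> 0 < Phi t -> kappa * Rpower (Phi t) (1 + p / 2) <= E t.

(* As [Phi' <= - delta kappa Phi^(1 + p/2)], the power [Phi^(- p/2)] grows at least linearly. *)
Lemma Phi_power_growth t : 0 <= t -> 0 < Phi t ->
  Rpower (Phi 0) (- (p / 2)) + p / 2 * delta * kappa * t <= Rpower (Phi t) (- (p / 2)).
Proof.
intros ht hp.
(* Monotonicity carries positivity back from [t], so the negative power is differentiable on the
   whole interval. *)
assert (hpos : forall s, 0 <= s <= t -> 0 < Phi s).
{ intros s hs; apply Rlt_le_trans with (1 := hp), Phi_nonincreasing; lra. }
assert (h : - Rpower (Phi t) (- (p / 2)) - - Rpower (Phi 0) (- (p / 2))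
  <= - (p / 2 * delta * kappa) * (t - 0)).
{ apply (increment_le (fun s => - Rpower (Phi s) (- (p / 2)))
    (fun s => - (dPhi s * (- (p / 2) * Rpower (Phi s) (- (p / 2) - 1))))); [exact ht | | |].
  - intros s hs.
    apply (is_derive_opp (V := R_NormedModule) (fun s => Rpower (Phi s) (- (p / 2)))).
    apply (is_derive_comp (fun x => Rpower x (- (p / 2))) Phi).
    + apply is_derive_Rpower, hpos; lra.
    + apply Phi_is_derive; lra.
  - intros s hs.
    assert (h1 := dPhi_le s ltac:(lra)).
    assert (h2 := Phi_le_E s ltac:(lra) (hpos s ltac:(lra))).
    assert (h3 : Rpower (Phi s) (- (p / 2) - 1) * Rpower (Phi s) (1 + p / 2) = 1).
    { rewrite <- Rpower_plus.
      replace (- (p / 2) - 1 + (1 + p / 2)) with 0 by ring.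
      apply Rpower_O, hpos; lra. }
    assert (h4 := Rpower_pos (Phi s) (- (p / 2) - 1)).
    set (a := Rpower (Phi s) (- (p / 2) - 1)) in *.
    assert (h5 : dPhi s <= - delta * (kappa * Rpower (Phi s) (1 + p / 2))) by nra.
    apply Rle_trans with
      (p / 2 * a * (- delta * (kappa * Rpower (Phi s) (1 + p / 2)))).
    + replace (- (dPhi s * (- (p / 2) * a))) with (p / 2 * a * dPhi s) by ring.
      apply Rmult_le_compat_l; [| exact h5].
      apply Rmult_le_pos; lra.
    + right.
      transitivity (- (p / 2 * delta * kappa) * (a * Rpower (Phi s) (1 + p / 2))); [ring |].
      rewrite h3; ring.
  - intros s hs.
    apply (continuous_opp (V := R_NormedModule) (fun s => Rpower (Phi s) (- (p / 2)))).
    apply (continuous_comp Phi (fun x => Rpower x (- (p / 2)))); [apply Phi_continuous |].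
    apply (ex_derive_continuous (V := R_NormedModule)).
    eexists; apply is_derive_Rpower, hpos, hs. }
lra.
Qed.

Hypothesis E_le_Phi : forall t, 0 <= t -> E t <= Phi t.

Lemma Phi_decay :
  exists C, 0 <= C /\ forall t, 0 <= t -> Phi t <= C / Rpower (1 + t) (2 / p).
Proof.
(* The affine lower bound on [Phi^(- p/2)] then dominates [m * (1 + t)]; raising to the power 2/p
   and inverting gives the decay. *)
set (m := Rmin (Rpower (Phi 0) (- (p / 2))) (p / 2 * delta * kappa)).
assert (hm : 0 < m).
{ apply Rmin_glb_lt; [apply Rpower_pos |].
  repeat apply Rmult_lt_0_compat; lra. }
exists (/ Rpower m (2 / p)).
assert (hC := Rinv_0_lt_compat _ (Rpower_pos m (2 / p))).
split; [lra |]; intros t ht.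
assert (hr := Rinv_0_lt_compat _ (Rpower_pos (1 + t) (2 / p))).
destruct (Rle_or_lt (Phi t) 0) as [h | h].
- apply Rle_trans with (1 := h); apply Rmult_le_pos; lra.
- assert (hg := Phi_power_growth t ht h).
  assert (h1 : m * (1 + t) <= Rpower (Phi t) (- (p / 2))).
  { assert (h1 := Rmin_l (Rpower (Phi 0) (- (p / 2))) (p / 2 * delta * kappa)).
    assert (h2 := Rmin_r (Rpower (Phi 0) (- (p / 2))) (p / 2 * delta * kappa)).
    fold m in h1, h2; nra. }
  assert (h2 : 0 < m * (1 + t)) by (apply Rmult_lt_0_compat; lra).
  assert (hq : 0 <= 2 / p) by (left; apply Rdiv_lt_0_compat; lra).
  assert (h3 := Rle_Rpower_l _ _ _ hq (conj h2 h1)).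
  rewrite <- Rpower_mult_distr in h3 by lra.
  rewrite Rpower_mult in h3.
  replace (- (p / 2) * (2 / p)) with (Ropp 1) in h3 by (field; lra).
  rewrite Rpower_Ropp, Rpower_1 in h3 by exact h.
  unfold Rdiv; rewrite <- Rinv_mult.
  rewrite <- (Rinv_inv (Phi t)).
  apply Rinv_le_contravar; [| exact h3].
  apply Rmult_lt_0_compat; apply Rpower_pos.
Qed.

Lemma E_decay :
  exists C, forall t, 0 <= t -> E t <= C / Rpower (1 + t) (1 + 2 / p).
Proof.
destruct Phi_decay as [C [hC hPhi]].
(* Split (1 + t) E as E + t E. The first term is at most Phi(t). As Phi(t) >= 0, the increment over
   [t/2, t] bounds the second by 2/delta times Phi(t/2), and 1 + t <= 2 (1 + t/2) yields the power
   of 2. *)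
exists (C * (1 + 2 / delta * Rpower 2 (2 / p))); intros t ht.
assert (hq : 0 <= 2 / p) by (left; apply Rdiv_lt_0_compat; lra).
assert (hP := Rpower_pos (1 + t) (2 / p)).
assert (h1 := Rle_trans _ _ _ (E_le_Phi t ht) (hPhi t ht)).
assert (h2 := Phi_increment (t / 2) t ltac:(lra) ltac:(lra)).
assert (h3 := hPhi (t / 2) ltac:(lra)).
assert (h4 := Rle_trans _ _ _ (E_ge t ht) (E_le_Phi t ht)).
assert (h5 : / Rpower (1 + t / 2) (2 / p) <= Rpower 2 (2 / p) * / Rpower (1 + t) (2 / p)).
{ assert (h5 : Rpower (1 + t) (2 / p) <= Rpower 2 (2 / p) * Rpower (1 + t / 2) (2 / p)).
  { rewrite Rpower_mult_distr by lra; apply Rle_Rpower_l; lra. }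
  assert (hP2 := Rpower_pos (1 + t / 2) (2 / p)).
  apply (Rmult_le_reg_r (Rpower (1 + t / 2) (2 / p) * Rpower (1 + t) (2 / p))); [nra |].
  field_simplify; lra. }
rewrite Rpower_plus, Rpower_1 by lra.
assert (h6 : t * E t <= 2 / delta * (C * (Rpower 2 (2 / p) * / Rpower (1 + t) (2 / p)))).
{ assert (h6 : Phi (t / 2) <= C * (Rpower 2 (2 / p) * / Rpower (1 + t) (2 / p))).
  { apply Rle_trans with (1 := h3); apply Rmult_le_compat_l; assumption. }
  apply (Rmult_le_reg_l (delta / 2)); [lra |].
  replace (delta / 2 * (2 / delta * (C * (Rpower 2 (2 / p) * / Rpower (1 + t) (2 / p)))))
    with (C * (Rpower 2 (2 / p) * / Rpower (1 + t) (2 / p))) by (field; lra).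
  lra. }
apply (Rmult_le_reg_r (1 + t)); [lra |].
replace (C * (1 + 2 / delta * Rpower 2 (2 / p)) / ((1 + t) * Rpower (1 + t) (2 / p)) * (1 + t))
  with (C / Rpower (1 + t) (2 / p)
    + 2 / delta * (C * (Rpower 2 (2 / p) * / Rpower (1 + t) (2 / p)))) by (field; lra).
lra.
Qed.

End Decay.

(** * The decay estimates *)

(** According to which term dominates, Phi is at most 2 n^2 or 10 E. In the first case (n^2)^(1 +
    p/2) = n^(p + 2) is controlled by assumption; in the second the surplus factor E^(p/2) is at
    most M^(p/2). *)
Lemma power_sum_bound (p n E Phi c M : R) :
  0 < p -> 0 <= n -> 0 <= E -> E <= M -> 0 < M -> 0 <= c -> 0 < Phi ->
  Phi <= n ^ 2 + 5 * E -> rpow n (p + 2) <= c * E ->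
  Rpower Phi (1 + p / 2)
    <= (Rpower 2 (1 + p / 2) * c + Rpower 10 (1 + p / 2) * Rpower M (p / 2)) * E.
Proof.
intros hp hn hE hEM hM hc hPhi hle hr.
assert (hq : 0 <= 1 + p / 2) by lra.
assert (h2 := Rpower_pos 2 (1 + p / 2)); assert (h10 := Rpower_pos 10 (1 + p / 2)).
assert (hMp := Rpower_pos M (p / 2)).
rewrite Rmult_plus_distr_r.
destruct (Rle_or_lt (5 * E) (n ^ 2)) as [h | h].
- assert (hn0 : 0 < n).
  { destruct (Rle_lt_or_eq_dec _ _ hn) as [h0 | <-]; [exact h0 | exfalso; simpl in h, hle; lra]. }
  apply Rle_trans with (Rpower (2 * (n * n)) (1 + p / 2)).
  { apply Rle_Rpower_l; [exact hq | split; [exact hPhi | simpl in *; lra]]. }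
  assert (hnn : 0 < n * n) by (apply Rmult_lt_0_compat; exact hn0).
  rewrite <- Rpower_mult_distr, <- Rpower_mult_distr, <- Rpower_plus by lra.
  replace (1 + p / 2 + (1 + p / 2)) with (p + 2) by field.
  unfold rpow in hr; destruct (Req_EM_T n 0) as [e | _]; [lra |].
  assert (0 <= Rpower 10 (1 + p / 2) * Rpower M (p / 2) * E)
    by (repeat apply Rmult_le_pos; lra).
  apply (Rmult_le_compat_l (Rpower 2 (1 + p / 2))) in hr; lra.
- assert (hE0 : 0 < E) by (assert (h0 := pow2_ge_0 n); lra).
  apply Rle_trans with (Rpower (10 * E) (1 + p / 2)).
  { apply Rle_Rpower_l; lra. }
  rewrite <- Rpower_mult_distr, Rpower_plus, Rpower_1 by lra.
  assert (hm : Rpower E (p / 2) <= Rpower M (p / 2)) by (apply Rle_Rpower_l; lra).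
  rewrite Rpower_plus, Rpower_1 in h10 |- * by lra.
  assert (0 <= 2 * Rpower 2 (p / 2) * c * E).
  { assert (h2' := Rpower_pos 2 (p / 2)); repeat apply Rmult_le_pos; lra. }
  rewrite (Rpower_plus 1 (p / 2) 2), (Rpower_1 2) by lra.
  assert (h3 : 10 * Rpower 10 (p / 2) * E * Rpower E (p / 2)
    <= 10 * Rpower 10 (p / 2) * E * Rpower M (p / 2)).
  { apply Rmult_le_compat_l; [apply Rmult_le_pos |]; lra. }
  lra.
Qed.

(** * Extension of curves from the half-line to the whole line *)

Lemma Rmax_0_within (t : R) :
  filterlim (fun s => Rmax 0 s) (locally t)
    (within (time_interval p_infty) (locally (Rmax 0 t))).
Proof.
intros P [d hd]; exists d; intros s hs.
apply hd; [| split; [apply Rmax_l | exact I]].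
change (Rabs (s - t) < d) in hs; change (Rabs (Rmax 0 s - Rmax 0 t) < d).
apply Rle_lt_trans with (2 := hs).
unfold Rmax; destruct (Rle_dec 0 s), (Rle_dec 0 t);
  unfold Rabs; repeat destruct Rcase_abs; lra.
Qed.

Lemma continuous_extend (V : UniformSpace) (f : R -> V) (t : R) :
  continuous_on (time_interval p_infty) f -> continuous (fun s => f (Rmax 0 s)) t.
Proof.
intros hf; apply (filterlim_comp _ _ _ _ f _ _ _ (Rmax_0_within t)), hf.
split; [apply Rmax_l | exact I].
Qed.

Lemma is_derive_extend (V : NormedModule R_AbsRing) (f : R -> V) (t : R) (v : V) :
  0 < t ->
  filterdiff f (within (time_interval p_infty) (locally t)) (fun h : R => scal h v) ->
  is_derive (fun s => f (Rmax 0 s)) t v.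
Proof.
intros ht [hl hd].
assert (hI : locally t (time_interval p_infty)).
{ exists (mkposreal t ht); intros s hs; change (Rabs (s - t) < t) in hs.
  apply Rabs_lt_between in hs; split; [lra | exact I]. }
apply (is_derive_ext_loc f).
{ revert hI; apply filter_imp; intros s [hs _]; now rewrite Rmax_right. }
split; [exact hl |]; intros x hx eps.
assert (h := hd x (fun P hP => filter_imp _ _ (fun s h _ => h) (hx P hP)) eps).
generalize (filter_and (F := locally t) _ _ h hI); apply filter_imp.
intros s [h1 h2]; now apply h1.
Qed.

Theorem theorem2p2
  (H : HilbertSpace) (A B : operator H H)
  (Hp1_self_adjoint : self_adjoint A)
  (Hp1_nonneg : nonneg_operator A)
  (B_sqrt : is_sqrt_operator A B)
  (F : Dom B -> R)
  (Hp2_nonneg : forall u : Dom B, 0 <= F u)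
  (Hp2_zero : F zero = 0)
  (gradF : Dom B -> H)
  (Hp3 : is_gradient F gradF)
  (Hp4 : exists L : R * R -> R,
     bounded_on_bounded_sets L /\
     forall u v : Dom B,
       norm (minus (gradF u) (gradF v)) <= L (norm u, norm v) * norm (minus u v))
  (Hp5 : exists K : R,
     0 < K /\ forall u : Dom B, K * F u <= inner (gradF u) (emb u))
  (p : R) (p_pos : 0 < p)
  (Hp6 : exists R1 : R -> R,
     bounded_on_bounded_sets R1 /\
     forall u : Dom B,
       rpow (norm (emb u)) (p + 2) <= R1 (norm u) * (norm (B u) ^ 2 + F u))
  (u0 : Dom B) (u1 : H)
  (u : R -> Dom B) (du : R -> H)
  (Hu : is_weak_solution A gradF u0 u1 p_infty u du) :
  exists M1 M2 : R,
    (forall t : R, 0 <= t ->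
       norm (du t) ^ 2 + norm (B (u t)) ^ 2 + F (u t)
         <= M1 / Rpower (1 + t) (1 + 2 / p)) /\
    (forall t : R, 0 <= t ->
       norm (emb (u t)) <= M2 / Rpower (1 + t) (1 / p)).
Proof.
destruct Hu as [hu [[hd hdu] [hU0 [S [hS hmild]]]]].
destruct Hp4 as [L [hL hLip]]; destruct Hp5 as [K [hK hKF]]; destruct Hp6 as [R1 [hR1 hF]].
(* Freezing the solution at its initial value for negative times turns continuity within the
   half-line into continuity at every real time; the mild formula only sees times where nothing
   changed. *)
set (v := fun t => u (Rmax 0 t)); set (dv := fun t => du (Rmax 0 t)).
assert (vE : forall t, 0 <= t -> v t = u t) by (intros t ht; unfold v; now rewrite Rmax_right).
assert (dvE : forall t, 0 <= t -> dv t = du t) by (intros t ht; unfold dv; now rewrite Rmax_right).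
assert (v_cont : forall t, continuous v t) by (intros t; now apply continuous_extend).
assert (dv_cont : forall t, continuous dv t) by (intros t; now apply continuous_extend).
assert (v_deriv : forall t, 0 < t -> is_derive (fun s => emb (v s)) t (dv t)).
{ intros t ht; rewrite dvE by lra.
  apply (is_derive_extend H (fun s => emb (u s))); [exact ht |].
  apply hd; split; [lra | exact I]. }
assert (g_cont : forall x, continuous gradF x)
  by (intros x; exact (locally_lipschitz_continuous (Dom_NormedModule B) H gradF L x hL hLip)).
assert (v_mild : forall t, 0 <= t -> exists J : energy_space B,
  is_RInt (fun s => S (- (t - s)) (forcing gradF (v s, dv s))) 0 t J /\
  (v t, dv t) = plus (S (- t) (v 0, dv 0)) J).
{ intros t ht; destruct (hmild t (conj ht I)) as [J [hJ e]]; exists J; split.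
  - apply (is_RInt_ext _ _ _ _ _) with (2 := hJ).
    intros s; rewrite Rmin_left, Rmax_right by exact ht; intros hs.
    now rewrite vE, dvE by lra.
  - rewrite !vE, !dvE by lra; exact e. }
set (E := fun t => (norm (dv t) ^ 2 + norm (B (v t)) ^ 2) / 2 + F (v t)).
set (Phi := fun t => (inner (dv t) (emb (v t)) + norm (emb (v t)) ^ 2 / 2) + 3 * E t).
set (dPhi := fun t => - 2 * norm (dv t) ^ 2 - norm (B (v t)) ^ 2 - inner (gradF (v t)) (emb (v t))).
(* [delta <= 2] lets the quadratic terms of [dPhi] absorb those of [delta * E]; [delta <= K] does
   the same for [F] through (Hp5). *)
set (delta := Rmin K 2).
assert (hdelta : 0 < delta) by (apply Rmin_glb_lt; lra).
assert (E_cont : forall t, continuous E t)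
  by (intros t; apply (energy_continuous Hp3 v_cont dv_cont)).
assert (Phi_cont : forall t, continuous Phi t).
{ intros t; apply (continuous_plus (V := R_NormedModule)).
  - apply (lyapunov_continuous v_cont dv_cont).
  - apply (continuous_mult (K := R_AbsRing)); [apply continuous_const | apply E_cont]. }
assert (E_deriv : forall t, 0 < t -> is_derive E t (- norm (dv t) ^ 2))
  by (exact (energy_is_derive B_sqrt Hp3 g_cont v_cont dv_cont v_deriv hS v_mild)).
assert (Phi_deriv : forall t, 0 < t -> is_derive Phi t (dPhi t)).
{ intros t ht.
  assert (h1 := cross_is_derive B_sqrt g_cont v_cont dv_cont v_deriv hS v_mild t ht).
  assert (h2 := pow2_norm_is_derive v_deriv t ht).
  assert (h3 := E_deriv t ht).
  apply (is_derive_ext (fun s => plus (plus (inner (dv s) (emb (v s)))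
    (scal (/ 2) (norm (emb (v s)) ^ 2))) (scal 3 (E s)))).
  { intros s; unfold Phi, plus, scal; simpl; unfold mult; simpl; field. }
  apply (is_derive_scal _ _ (/ 2)) in h2.
  apply (is_derive_scal _ _ 3) in h3.
  assert (h := is_derive_plus _ _ _ _ _ (is_derive_plus _ _ _ _ _ h1 h2) h3).
  match type of h with is_derive _ _ ?l => replace (dPhi t) with l; [exact h |] end.
  unfold dPhi, plus, scal; simpl; unfold mult; simpl; field. }
assert (hn2 : forall x : H, 0 <= norm x ^ 2) by (intros x; apply pow2_ge_0).
assert (dE_le : forall t, 0 < t -> - norm (dv t) ^ 2 <= 0)
  by (intros t _; assert (h := hn2 (dv t)); lra).
assert (dPhi_le : forall t, 0 < t -> dPhi t <= - delta * E t).
{ intros t _.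
  assert (h1 := hKF (v t)); assert (h2 := Hp2_nonneg (v t)).
  assert (h3 := hn2 (dv t)); assert (h4 := hn2 (B (v t))).
  assert (h5 := Rmin_l K 2); assert (h6 := Rmin_r K 2); fold delta in h5, h6.
  unfold dPhi, E; nra. }
assert (E_ge : forall t, 0 <= t -> 0 <= E t).
{ intros t _; assert (h2 := Hp2_nonneg (v t)).
  assert (h3 := hn2 (dv t)); assert (h4 := hn2 (B (v t))); unfold E; lra. }
assert (hcross : forall t, Rabs (inner (dv t) (emb (v t)))
  <= norm (emb (v t)) ^ 2 / 4 + norm (dv t) ^ 2).
{ intros t; apply Rle_trans with (1 := sp_cauchy_schwarz (inner_scalar_product H) _ _).
  assert (h := pow2_ge_0 (norm (emb (v t)) / 2 - norm (dv t))); lra. }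
assert (Phi_ge : forall t, norm (emb (v t)) ^ 2 / 4 + E t <= Phi t).
{ intros t; assert (h := hcross t); apply Rabs_le_between in h.
  assert (h2 := Hp2_nonneg (v t)); assert (h4 := hn2 (B (v t))).
  unfold Phi, E; lra. }
assert (E_le_Phi : forall t, 0 <= t -> E t <= Phi t).
{ intros t _; assert (h := Phi_ge t); assert (h1 := hn2 (emb (v t))); lra. }
assert (Phi_le0 : forall t, 0 <= t -> Phi t <= Phi 0).
{ intros t ht.
  exact (Phi_nonincreasing hdelta E_cont Phi_cont E_deriv Phi_deriv dE_le dPhi_le E_ge
    0 t (Rle_refl 0) ht). }
assert (hPhi0 := Rle_trans _ _ _ (E_ge 0 (Rle_refl 0)) (E_le_Phi 0 (Rle_refl 0))).
(* The squared graph norm stays below [6 * Phi 0], since |u|^2 <= 4 Phi and |Bu|^2 <= 2E <= 2 Phi. A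
   square at most c >= 0 has root at most 1 + c, which avoids a square root. *)
destruct (hR1 (1 + 6 * Phi 0)) as [C1 hC1].
assert (hbound : forall t, 0 <= t -> Rabs (R1 (norm (v t))) <= C1).
{ intros t ht; apply hC1.
  change (Rabs (norm (v t)) <= 1 + 6 * Phi 0).
  rewrite Rabs_pos_eq by apply norm_ge_0.
  assert (e := Dom_norm_pow2 (v t)); assert (h1 := Phi_le0 t ht); assert (h2 := Phi_ge t).
  assert (h3 := Hp2_nonneg (v t)); assert (h4 := hn2 (dv t)); assert (h5 := hn2 (B (v t))).
  assert (h6 := hn2 (emb (v t))).
  assert (h7 : norm (B (v t)) ^ 2 <= 2 * E t) by (unfold E; lra).
  assert (h8 : norm (v t) ^ 2 <= 6 * Phi 0) by lra.
  nra. }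
assert (hC1pos : 0 <= C1)
  by (apply Rle_trans with (2 := hbound 0 (Rle_refl 0)), Rabs_pos).
(* The constant of [power_sum_bound] with [c = 2 * C1], because |Bu|^2 + F <= 2E, and
   [M = Phi 0 + 1], which bounds E and is positive even if [Phi 0 = 0]. *)
set (D := Rpower 2 (1 + p / 2) * (2 * C1) + Rpower 10 (1 + p / 2) * Rpower (Phi 0 + 1) (p / 2)).
assert (hD : 0 < D).
{ assert (h2 := Rpower_pos 2 (1 + p / 2)); assert (h10 := Rpower_pos 10 (1 + p / 2)).
  assert (hM := Rpower_pos (Phi 0 + 1) (p / 2)).
  apply Rplus_le_lt_0_compat; [apply Rmult_le_pos | apply Rmult_lt_0_compat]; lra. }
assert (Phi_le_E : forall t, 0 <= t -> 0 < Phi t -> / D * Rpower (Phi t) (1 + p / 2) <= E t).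
{ intros t ht hpos.
  apply (Rmult_le_reg_l D); [exact hD |].
  rewrite <- Rmult_assoc, Rinv_r, Rmult_1_l by lra.
  assert (h1 := E_ge t ht); assert (h2 := E_le_Phi t ht); assert (h3 := Phi_le0 t ht).
  assert (h4 := hn2 (B (v t))); assert (h5 := Hp2_nonneg (v t)); assert (h6 := hn2 (dv t)).
  apply (power_sum_bound p (norm (emb (v t)))); try lra.
  - apply norm_ge_0.
  - assert (h := hcross t); apply Rabs_le_between in h.
    assert (h7 : norm (dv t) ^ 2 <= 2 * E t) by (unfold E; lra).
    assert (h8 := hn2 (emb (v t))).
    unfold Phi; lra.
  - apply Rle_trans with (1 := hF (v t)).
    assert (h := Rle_trans _ _ _ (Rle_abs _) (hbound t ht)).
    apply Rle_trans with (C1 * (norm (B (v t)) ^ 2 + F (v t))).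
    + apply Rmult_le_compat_r; lra.
    + replace (2 * C1 * E t) with (C1 * (2 * E t)) by ring.
      apply Rmult_le_compat_l; [exact hC1pos | unfold E; lra]. }
assert (hkappa := Rinv_0_lt_compat _ hD).
destruct (E_decay p_pos hdelta hkappa E_cont Phi_cont E_deriv Phi_deriv dE_le dPhi_le E_ge
  Phi_le_E E_le_Phi) as [CE hCE].
destruct (Phi_decay p_pos hdelta hkappa E_cont Phi_cont E_deriv Phi_deriv dE_le dPhi_le E_ge
  Phi_le_E) as [CP [hCP0 hCP]].
(* The left side of the first estimate is at most 2E, and |u|^2 <= 4 Phi gives the second after a
   square root. *)
exists (2 * CE), (2 * sqrt CP); split; intros t ht.
- rewrite <- vE, <- dvE by exact ht.
  assert (h := hCE t ht); assert (h2 := Hp2_nonneg (v t)).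
  unfold Rdiv in *; rewrite Rmult_assoc; unfold E in h; lra.
- rewrite <- vE by exact ht.
  assert (h1 := hCP t ht); assert (h2 := Phi_ge t); assert (h3 := E_ge t ht).
  assert (hP := Rpower_pos (1 + t) (1 / p)).
  replace (2 / p) with (1 / p + 1 / p) in h1 by (field; lra).
  rewrite Rpower_plus in h1.
  apply Rsqr_incr_0.
  + unfold Rsqr.
    replace (2 * sqrt CP / Rpower (1 + t) (1 / p) * (2 * sqrt CP / Rpower (1 + t) (1 / p)))
      with (4 * ((sqrt CP * sqrt CP) / (Rpower (1 + t) (1 / p) * Rpower (1 + t) (1 / p))))
      by (field; lra).
    rewrite sqrt_sqrt by exact hCP0; simpl in h2; lra.
  + apply norm_ge_0.
  + assert (h4 := sqrt_pos CP).
    apply Rmult_le_pos; [lra | left; now apply Rinv_0_lt_compat].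
Qed.
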